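(* Let $n\in\mathbb N_0$, $0<q<1$, let $a,b,c,d\in\mathbb C\setminus\{0\}$ be such that $0<ab<1$ and $0<cd<1$, let $z\in\mathbb C\setminus\{0\}$ and $x=\frac12(z+z^{-1})$, where the parameters are such that no denominator below vanishes. Then $$\sum_{k=0}^\infty q^{\binom k2}(-c)^k\,\frac{(\frac{abcd}{q},\sqrt{qabcd},-\sqrt{qabcd};q)_k}{(q,\sqrt{\frac{abcd}{q}},-\sqrt{\frac{abcd}{q}},ac,bc,cd;q)_k}\;Q_n\!\left[\frac{q^{\frac12-k}}{\sqrt{abcd}};\sqrt{\frac{q}{abcd}},\sqrt{\frac{cd}{qab}}\,\Big|\,q^{-1}\right]p_k(x;a,b,c,d|q)$$ $$=q^{-\binom n2}\,\frac{(abcd,cz,cz^{-1};q)_\infty}{(ac,bc,cd;q)_\infty}\left(-\sqrt{\frac{c}{qabd}}\right)^n Q_n(x;a,b|q).$$ Here $\sqrt{abcd}$, $\sqrt{qabcd}$, $\sqrt{abcd/q}$, $\sqrt{q/(abcd)}$ and $\sqrt{cd/(qab)}$ are positive square roots, and $\sqrt{c/(qabd)}$ denotes the square root equal to $c/\sqrt{qabcd}$.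
   Context: $(a;q)_n=\prod_{j=0}^{n-1}(1-aq^j)$, $(a;q)_\infty=\lim_{n\to\infty}(a;q)_n$, $(a_1,\dots,a_k;q)_n=\prod_i(a_i;q)_n$. The basic hypergeometric series is ${}_r\phi_s\!\left(\begin{matrix}a_1,\dots,a_r\\ b_1,\dots,b_s\end{matrix};q,z\right)=\sum_{k\ge0}\frac{(a_1,\dots,a_r;q)_k}{(q,b_1,\dots,b_s;q)_k}\big((-1)^kq^{\binom k2}\big)^{1+s-r}z^k$. With $x=\frac12(z+z^{-1})$: the Askey--Wilson polynomials are $$p_n(x;a,b,c,d|q)=a^{-n}(ab,ac,ad;q)_n\,{}_4\phi_3\!\left(\begin{matrix}q^{-n},q^{n-1}abcd,az,az^{-1}\\ ab,ac,ad\end{matrix};q,q\right)$$ (symmetric in $a,b,c,d$); the Al-Salam--Chihara polynomials are $$Q_n(x;a,b|q)=a^{-n}(ab;q)_n\,{}_3\phi_2\!\left(\begin{matrix}q^{-n},az,az^{-1}\\ ab,0\end{matrix};q,q\right);$$ the $q^{-1}$-Al-Salam--Chihara polynomials are $$Q_n(x;a,b|q^{-1})=q^{-\binom n2}(-b)^n\left(\tfrac1{ab};q\right)_n\,{}_3\phi_1\!\left(\begin{matrix}q^{-n},\frac{z}{a},\frac{1}{az}\\ \frac1{ab}\end{matrix};q,\frac{q^na}{b}\right),$$ and $Q_n[w;a,b|q^{-1}]$ denotes $Q_n(x;a,b|q^{-1})$ evaluated at $x=\frac12(w+w^{-1})$. *)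

(* Defs.v *)
From Stdlib Require Import Reals List ZArith Lra.
From Coquelicot Require Import Coquelicot.
Import ListNotations.
Open Scope C_scope.

(** [Coquelicot]'s [Series] and [Lim_seq] are real-valued.  These are the complex
    versions; like the real ones they are total, with an unspecified value when
    there is no limit. *)
Definition CLim_seq (u : nat -> C) : C :=
  @iota C_CompleteNormedModule (fun l : C => filterlim u eventually (locally l)).

Definition CSeries (u : nat -> C) : C :=
  @iota C_CompleteNormedModule (fun l : C => is_series u l).

Lemma CLim_seq_unique (u : nat -> C) (l : C) :
  filterlim u eventually (locally l) -> CLim_seq u = l.
Proof.
  intro H.
  assert (U : forall x y : C, filterlim u eventually (locally x) ->
                filterlim u eventually (locally y) -> x = y).
  { intros x y Hx Hy.
    exact (filterlim_locally_unique (F := eventually) (V := C_NormedModule)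
             u x y Hx Hy). }
  symmetry; apply U; trivial.
  apply (iota_correct (V := C_CompleteNormedModule)
           (fun l : C => filterlim u eventually (locally l))).
  exists l; split; auto.
Qed.

Lemma CSeries_unique (u : nat -> C) (l : C) : is_series u l -> CSeries u = l.
Proof. exact (CLim_seq_unique (sum_n u) l). Qed.

Definition Cpowz (w : C) (m : Z) : C :=
  match m with
  | Z0 => 1
  | Zpos p => w ^ Pos.to_nat p
  | Zneg p => / w ^ Pos.to_nat p
  end.

(** The positive square root, meaningful only when [w] is a positive real. *)
Definition psqrt (w : C) : C := RtoC (sqrt (Re w)).

Definition binom2 (k : nat) : nat := (k * (k - 1) / 2)%nat.

Fixpoint qpoch (a q : C) (n : nat) : C :=
  match n with
  | O => 1
  | S m => qpoch a q m * (1 - a * q ^ m)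
  end.

Definition qpoch_inf (a q : C) : C := CLim_seq (qpoch a q).

Definition qpochs (l : list C) (q : C) (n : nat) : C :=
  fold_right (fun a r => qpoch a q n * r) 1 l.

Definition qpochs_inf (l : list C) (q : C) : C :=
  fold_right (fun a r => qpoch_inf a q * r) 1 l.

Definition qhyp_term (l m : list C) (q z : C) (k : nat) : C :=
  qpochs l q k / qpochs (q :: m) q k
  * Cpowz ((- (1)) ^ k * q ^ binom2 k)
      (1 + Z.of_nat (length m) - Z.of_nat (length l))
  * z ^ k.

Definition qhyp (l m : list C) (q z : C) : C := CSeries (qhyp_term l m q z).

(** The polynomials below are given as functions of [z], and stand for the value at
    [x = (z + 1/z) / 2]; the lemmas at the end of the file show that they depend
    on [z] only through [x].  The formulas are meant for nonvanishing denominators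
    [(ab, ac, ad; q)_k], [(ab; q)_k] and [(1/(ab); q)_k] respectively. *)

Definition askey_wilson (n : nat) (a b c d q z : C) : C :=
  / a ^ n * qpochs [a * b; a * c; a * d] q n
  * qhyp [/ q ^ n; Cpowz q (Z.of_nat n - 1) * (a * b * c * d); a * z; a / z]
         [a * b; a * c; a * d] q q.

Definition al_salam_chihara (n : nat) (a b q z : C) : C :=
  / a ^ n * qpochs [a * b] q n
  * qhyp [/ q ^ n; a * z; a / z] [a * b; RtoC 0] q q.

(** The polynomial written [Q_n(x; a, b | q^-1)]; the base passed here is [q],
    not its inverse. *)
Definition qinv_al_salam_chihara (n : nat) (a b q z : C) : C :=
  / q ^ binom2 n * (- b) ^ n * qpochs [/ (a * b)] q n
  * qhyp [/ q ^ n; z / a; / (a * z)] [/ (a * b)] q (q ^ n * a / b).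

Lemma joukowski_eq (z w : C) :
  z <> 0 -> w <> 0 -> (z + / z) / 2 = (w + / w) / 2 -> z = w \/ z = / w.
Proof.
  intros Hz Hw H.
  assert (H2 : RtoC 2 <> 0) by (intro E; apply RtoC_inj in E; lra).
  assert (E : (z - w) * (z - / w) = 0).
  { assert (E1 : z + / z = w + / w).
    { replace (z + / z) with (2 * ((z + / z) / 2)) by (field; auto).
      rewrite H; field; auto. }
    replace ((z - w) * (z - / w)) with (z * (z + / z - (w + / w)))
      by (field; auto).
    rewrite E1; ring. }
  destruct (Ceq_dec (z - w) 0) as [e | ne].
  - left. replace z with (z - w + w) by ring. rewrite e; ring.
  - right. destruct (Ceq_dec (z - / w) 0) as [e | ne'].
    + replace z with (z - / w + / w) by ring. rewrite e; ring.
    + exfalso; exact (Cmult_neq_0 _ _ ne ne' E).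
Qed.

Lemma qhyp_swap (l : list C) (u v : C) (r m : list C) (q t : C) :
  qhyp (l ++ u :: v :: r) m q t = qhyp (l ++ v :: u :: r) m q t.
Proof.
  unfold qhyp; f_equal.
  apply FunctionalExtensionality.functional_extensionality; intro k.
  unfold qhyp_term.
  replace (qpochs (l ++ u :: v :: r) q k) with (qpochs (l ++ v :: u :: r) q k).
  - now rewrite !length_app.
  - unfold qpochs; induction l as [| p l IH]; simpl.
    + ring.
    + now rewrite IH.
Qed.

Lemma askey_wilson_x (n : nat) (a b c d q z w : C) :
  z <> 0 -> w <> 0 -> (z + / z) / 2 = (w + / w) / 2 ->
  askey_wilson n a b c d q z = askey_wilson n a b c d q w.
Proof.
  intros Hz Hw H; destruct (joukowski_eq z w Hz Hw H) as [-> | ->]; trivial.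
  unfold askey_wilson; f_equal.
  refine (eq_trans (qhyp_swap [_; _] _ _ [] _ _ _) _); cbn [app].
  now replace (a * / w) with (a / w) by reflexivity;
    replace (a / / w) with (a * w) by (field; auto).
Qed.

Lemma al_salam_chihara_x (n : nat) (a b q z w : C) :
  z <> 0 -> w <> 0 -> (z + / z) / 2 = (w + / w) / 2 ->
  al_salam_chihara n a b q z = al_salam_chihara n a b q w.
Proof.
  intros Hz Hw H; destruct (joukowski_eq z w Hz Hw H) as [-> | ->]; trivial.
  unfold al_salam_chihara; f_equal.
  refine (eq_trans (qhyp_swap [_] _ _ [] _ _ _) _); cbn [app].
  now replace (a * / w) with (a / w) by reflexivity;
    replace (a / / w) with (a * w) by (field; auto).
Qed.

Lemma qinv_al_salam_chihara_x (n : nat) (a b q z w : C) :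
  a <> 0 -> z <> 0 -> w <> 0 -> (z + / z) / 2 = (w + / w) / 2 ->
  qinv_al_salam_chihara n a b q z = qinv_al_salam_chihara n a b q w.
Proof.
  intros Ha Hz Hw H; destruct (joukowski_eq z w Hz Hw H) as [-> | ->]; trivial.
  unfold qinv_al_salam_chihara; f_equal.
  refine (eq_trans (qhyp_swap [_] _ _ [] _ _ _) _); cbn [app].
  replace (/ (a * / w)) with (w / a) by (field; auto).
  now replace (/ w / a) with (/ (a * w)) by (field; auto).
Qed.

(* Main.v *)
(** Expand the dual polynomial in its hypergeometric basis; the theorem then splits
    into finitely many series, one for each basis element [(q^-k, q^(k-1) abcd; q)_i].
    The raising operator of the Askey-Wilson polynomials (the adjoint of their
    divided-difference operator) is symmetric in [a, b, c, d], which gives the symmetry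
    of [p_n]; applied to the expansion of [p_m] in the basis [(cz, c/z; q)_j], it gives
    an expansion of [p_{i+m}(x; a, b, c, d)] with coefficients
    [(cz, c/z; q)_j p_i(x; a, b, c q^j, d)].  With it the partial sums of the [i]-th
    series telescope to a single sum, whose limit is, by Tannery's theorem, a multiple
    of [(cz, c/z; q)_oo p_i(x; a, b, 0, d)].  A connection formula recombines these
    continuous dual q-Hahn polynomials into [Q_n(x; a, b | q)]. *)

(* For a fixed basis element [i], expanding every [p_(i+m)] in [j] gives a double series whose order
   of summation cannot be exchanged: for fixed [j] the partial sums over [m] carry the factor
   [euler_coef q (M - j)] and tend to zero, while the total is not zero in general. The whole limit
   comes from indices [j] near the upper end [M]. So the partial sum is kept exact and read
   backwards with [l = M - j]; the weights then form Euler's series for [(q; q)_oo], and all other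
   factors converge for fixed [l].

   The parameter [c] is singled out because the coefficients in the basis [(cz, c/z; q)_j] reduce
   the denominators [(ac, bc, cd; q)_(i+m)] of the series to [(ac, bc, cd; q)_(i+j)], which have a
   limit in [j]. Since the inductions multiply all parameters by [sqrt q] and the limit sets one of
   them to zero, the polynomials are handled in a form without parameter denominators. *)
Require Import Defs.
From Stdlib Require Import Reals List Lra Lia.
From Coquelicot Require Import Coquelicot.
Import ListNotations.
Open Scope C_scope.

(** * Finite sums of complex numbers *)

(** [sum_n] with its type unfolded to [C], so that [ring] and [field] see it as an atom. *)
Definition csum (u : nat -> C) (n : nat) : C := sum_n u n.

Lemma Cinv_neq_0 (x : C) : x <> 0 -> / x <> 0.
Proof.
  intros Hx E; apply C1_nz; rewrite <- (Cinv_r x), E by trivial; ring.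
Qed.

Lemma csum_0 (u : nat -> C) : csum u 0 = u O.
Proof. exact (sum_O (G := C_AbelianMonoid) u). Qed.

Lemma csum_S (u : nat -> C) (n : nat) : csum u (S n) = csum u n + u (S n).
Proof. exact (sum_Sn (G := C_AbelianMonoid) u n). Qed.

Lemma csum_ext (u v : nat -> C) (n : nat) :
  (forall k, (k <= n)%nat -> u k = v k) -> csum u n = csum v n.
Proof. exact (sum_n_ext_loc (G := C_AbelianMonoid) u v n). Qed.

Lemma csum_scal (x : C) (u : nat -> C) (n : nat) :
  csum (fun k => x * u k) n = x * csum u n.
Proof. exact (sum_n_mult_l (K := C_Ring) x u n). Qed.

Lemma csum_minus (u v : nat -> C) (n : nat) :
  csum (fun k => u k - v k) n = csum u n - csum v n.
Proof.
  induction n as [|n IH]; rewrite ?csum_0, ?csum_S; [|rewrite IH]; ring.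
Qed.

Lemma csum_switch (u : nat -> nat -> C) (m n : nat) :
  csum (fun i => csum (u i) n) m = csum (fun j => csum (fun i => u i j) m) n.
Proof. exact (sum_n_switch (G := C_AbelianMonoid) u m n). Qed.

Lemma csum_split_first (u : nat -> C) (n : nat) :
  csum u (S n) = u O + csum (fun k => u (S k)) n.
Proof.
  induction n as [|n IH].
  - now rewrite csum_S, !csum_0.
  - rewrite csum_S, IH, csum_S; ring.
Qed.

Lemma csum_rev (u : nat -> C) (n : nat) :
  csum u n = csum (fun k => u (n - k)%nat) n.
Proof.
  induction n as [|n IH].
  - now rewrite !csum_0.
  - rewrite csum_S, csum_split_first, IH, Nat.sub_0_r; simpl; ring.
Qed.

(** Collects coefficients after an operator has sent the basis element [j] to a combination of [f j]
    and [f (S j)]. The raising operator has this shape, and so do the two q-Pascal recurrences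
    below, with [f] constantly 1. *)
Lemma csum_bidiagonal (e x y f : nat -> C) (k : nat) :
  e O = x O -> (forall j, (j < k)%nat -> e (S j) = x (S j) - y j) ->
  e (S k) = - y k ->
  csum (fun j => x j * f j - y j * f (S j)) k = csum (fun j => e j * f j) (S k).
Proof.
  intros H0 HS Hk; rewrite csum_S, Hk; clear Hk.
  induction k as [|k IH].
  - rewrite !csum_0, H0; ring.
  - rewrite csum_S, IH by (intros; apply HS; lia).
    rewrite (csum_S _ k), HS by lia; ring.
Qed.

(** * Finite q-shifted factorials *)

Lemma qpoch_S (a q : C) (n : nat) : qpoch a q (S n) = qpoch a q n * (1 - a * q ^ n).
Proof. reflexivity. Qed.

Lemma qpoch_add (a q : C) (m n : nat) :
  qpoch a q (m + n) = qpoch a q m * qpoch (a * q ^ m) q n.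
Proof.
  induction n as [|n IH].
  - rewrite Nat.add_0_r; simpl; ring.
  - rewrite Nat.add_succ_r, !qpoch_S, IH, Cpow_add_r; ring.
Qed.

Lemma qpoch_S_l (a q : C) (n : nat) :
  qpoch a q (S n) = (1 - a) * qpoch (a * q) q n.
Proof.
  change (S n) with (1 + n)%nat; rewrite qpoch_add; simpl.
  now replace (a * (q * 1)) with (a * q) by ring; ring.
Qed.

Lemma qpoch_0_l (q : C) (n : nat) : qpoch 0 q n = 1.
Proof. induction n as [|n IH]; [easy|]; rewrite qpoch_S, IH; ring. Qed.

Lemma qpoch_inv_pow (q : C) (n j : nat) :
  q <> 0 -> (n < j)%nat -> qpoch (/ q ^ n) q j = 0.
Proof.
  intros Hq Hj; replace j with (S n + (j - S n))%nat by lia.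
  rewrite qpoch_add, qpoch_S, Cinv_l by now apply Cpow_nz.
  ring.
Qed.

Lemma qpoch_inv_pow_S (q : C) (k j : nat) : q <> 0 ->
  qpoch (/ q ^ S k) q (S j) = (1 - / (q * q ^ k)) * qpoch (/ q ^ k) q j.
Proof.
  intros Hq; rewrite qpoch_S_l, Cpow_S.
  replace (/ (q * q ^ k) * q) with (/ q ^ k); [easy|].
  field; split; trivial; now apply Cpow_nz.
Qed.

(** * The raising operator of the Askey-Wilson polynomials *)

(** Here [(x q^j)_(k-j)] stands for the quotient [(x)_k / (x)_j] with [x] one of [ab], [ac],
    [ad]. *)
Definition aw_coef (q : C) (k : nat) (a b c d : C) (j : nat) : C :=
  qpoch (/ q ^ k) q j * qpoch (a * b * c * d / q * q ^ k) q j * q ^ j / qpoch q q j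
  * (qpoch (a * b * q ^ j) q (k - j) * qpoch (a * c * q ^ j) q (k - j)
     * qpoch (a * d * q ^ j) q (k - j)).

(** The Askey-Wilson polynomial with the denominators cancelled against the
    prefactor, so that it is meaningful whenever [a <> 0]. *)
Definition aw_poly (q : C) (k : nat) (a b c d z : C) : C :=
  / a ^ k
  * csum (fun j => aw_coef q k a b c d j * (qpoch (a * z) q j * qpoch (a / z) q j)) k.

(** The recurrence dictated by [aw_op_basis]: the basis element [S j] receives contributions from
    [S j] and from [j]. Multiplying all parameters by [r] multiplies each product of two by [q], so
    no [r] survives. The two lemmas that follow are the boundary cases of [csum_bidiagonal]. *)
Lemma aw_coef_rec (q r : C) (k j : nat) (a b c d : C) :
  q <> 0 -> (forall n, qpoch q q n <> 0) -> r * r = q -> (j < k)%nat ->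
  aw_coef q (S k) a b c d (S j) =
  (1 - a * b * q ^ S j) * (1 - a * c * q ^ S j) * (1 - a * d * q ^ S j) / q ^ S j
    * aw_coef q k (a * r) (b * r) (c * r) (d * r) (S j)
  - (1 - a * b * c * d * q ^ j) / q ^ j
    * aw_coef q k (a * r) (b * r) (c * r) (d * r) j.
Proof.
  intros Hq Hqn Hr Hj; unfold aw_coef.
  replace (a * r * (b * r)) with (a * b * q) by (rewrite <- Hr; ring).
  replace (a * r * (c * r)) with (a * c * q) by (rewrite <- Hr; ring).
  replace (a * r * (d * r)) with (a * d * q) by (rewrite <- Hr; ring).
  replace (a * b * q * (c * r) * (d * r)) with (a * b * c * d * q * q)
    by (rewrite <- Hr; ring).
  assert (Hs : forall x, qpoch (x * q ^ S j) q (S k - S j) =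
     (1 - x * q ^ S j) * qpoch (x * q * q ^ S j) q (k - S j)).
  { intro x; replace (S k - S j)%nat with (S (k - S j)) by lia.
    rewrite qpoch_S_l; now replace (x * q ^ S j * q) with (x * q * q ^ S j) by ring. }
  assert (Ht : forall x, qpoch (x * q * q ^ j) q (k - j) =
     (1 - x * q ^ S j) * qpoch (x * q * q ^ S j) q (k - S j)).
  { intro x; rewrite <- Hs; simpl Nat.sub.
    now replace (x * q * q ^ j) with (x * q ^ S j) by (simpl; ring). }
  rewrite !Hs, !Ht.
  rewrite qpoch_inv_pow_S by easy.
  rewrite (qpoch_S_l (a * b * c * d / q * q ^ S k)).
  replace (a * b * c * d / q * q ^ S k * q) with (a * b * c * d * q * q / q * q ^ k)
    by (simpl; field; easy).
  rewrite !(qpoch_S _ q j).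
  assert (Hj1 := Hqn (S j)); rewrite qpoch_S in Hj1.
  assert (Hqj := Hqn j).
  assert (H1 : 1 - q * q ^ j <> 0) by (intro E; apply Hj1; rewrite E; ring).
  assert (Hk0 : q ^ k <> 0) by now apply Cpow_nz.
  assert (Hj0 : q ^ j <> 0) by now apply Cpow_nz.
  simpl Cpow; field; auto.
Qed.

Lemma aw_coef_rec_0 (q r : C) (k : nat) (a b c d : C) : r * r = q ->
  aw_coef q (S k) a b c d 0 =
  (1 - a * b) * (1 - a * c) * (1 - a * d)
    * aw_coef q k (a * r) (b * r) (c * r) (d * r) 0.
Proof.
  intros Hr; unfold aw_coef.
  replace (a * r * (b * r)) with (a * b * q) by (rewrite <- Hr; ring).
  replace (a * r * (c * r)) with (a * c * q) by (rewrite <- Hr; ring).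
  replace (a * r * (d * r)) with (a * d * q) by (rewrite <- Hr; ring).
  rewrite !Nat.sub_0_r, !qpoch_S_l; simpl Cpow; rewrite !Cmult_1_r; simpl; field.
Qed.

Lemma aw_coef_rec_last (q r : C) (k : nat) (a b c d : C) :
  q <> 0 -> (forall n, qpoch q q n <> 0) -> r * r = q ->
  aw_coef q (S k) a b c d (S k) =
  - ((1 - a * b * c * d * q ^ k) / q ^ k
     * aw_coef q k (a * r) (b * r) (c * r) (d * r) k).
Proof.
  intros Hq Hqn Hr; unfold aw_coef.
  replace (a * r * (b * r)) with (a * b * q) by (rewrite <- Hr; ring).
  replace (a * b * q * (c * r) * (d * r)) with (a * b * c * d * q * q)
    by (rewrite <- Hr; ring).
  rewrite !Nat.sub_diag, qpoch_inv_pow_S by easy.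
  rewrite (qpoch_S_l (a * b * c * d / q * q ^ S k)).
  replace (a * b * c * d / q * q ^ S k * q) with (a * b * c * d * q * q / q * q ^ k)
    by (simpl; field; easy).
  rewrite (qpoch_S _ q k).
  assert (Hj1 := Hqn (S k)); rewrite qpoch_S in Hj1.
  assert (Hqj := Hqn k).
  assert (H1 : 1 - q * q ^ k <> 0) by (intro E; apply Hj1; rewrite E; ring).
  assert (Hk0 : q ^ k <> 0) by now apply Cpow_nz.
  simpl Cpow; cbn [qpoch Nat.sub]; field; auto.
Qed.

Definition aw_weight (a b c d z : C) : C :=
  (1 - a * z) * (1 - b * z) * (1 - c * z) * (1 - d * z) / (z * z).

(** [(1/z - z)] times the adjoint of the Askey-Wilson divided-difference operator;
    [r] stands for the square root of [q]. *)
Definition aw_op (r a b c d : C) (f : C -> C) (z : C) : C :=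
  aw_weight a b c d z * f (r * z) - aw_weight a b c d (/ z) * f (z / r).

(** The weight supplies the missing factor: [(1 - a z) (a z q)_j = (a z)_j (1 - a z q^j)], and
    likewise for [1/z]. Once [(a z)_j (a/z)_j] is taken out, a Laurent polynomial antisymmetric
    under [z -> 1/z] remains, whence the factor [/ z - z]. *)
Lemma aw_op_basis (q r a b c d z : C) (j : nat) :
  q <> 0 -> r * r = q -> a <> 0 -> z <> 0 ->
  aw_op r a b c d (fun w => qpoch (a * r * w) q j * qpoch (a * r / w) q j) z =
  (/ z - z) * / a *
  ((1 - a * b * q ^ j) * (1 - a * c * q ^ j) * (1 - a * d * q ^ j) / q ^ j
     * (qpoch (a * z) q j * qpoch (a / z) q j)
   - (1 - a * b * c * d * q ^ j) / q ^ j
     * (qpoch (a * z) q (S j) * qpoch (a / z) q (S j))).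
Proof.
  intros Hq Hr Ha Hz.
  assert (Hr0 : r <> 0) by (intro E; apply Hq; rewrite <- Hr, E; ring).
  unfold aw_op, aw_weight.
  replace (a * r * (r * z)) with (a * z * q) by (rewrite <- Hr; ring).
  replace (a * r / (r * z)) with (a / z) by (field; auto).
  replace (a * r * (z / r)) with (a * z) by (field; auto).
  replace (a * r / (z / r)) with (a / z * q) by (rewrite <- Hr; field; auto).
  assert (E1 := qpoch_S_l (a * z) q j); assert (E2 := qpoch_S_l (a / z) q j).
  rewrite qpoch_S in E1, E2.
  transitivity (
    (1 - b * z) * (1 - c * z) * (1 - d * z) / (z * z)
      * ((1 - a * z) * qpoch (a * z * q) q j) * qpoch (a / z) q j
    - (1 - b / z) * (1 - c / z) * (1 - d / z) * (z * z)
      * ((1 - a / z) * qpoch (a / z * q) q j) * qpoch (a * z) q j).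
  { field; auto. }
  rewrite <- E1, <- E2, !qpoch_S.
  assert (Hj0 : q ^ j <> 0) by now apply Cpow_nz.
  field; auto.
Qed.

Lemma aw_op_scal (r a b c d z x : C) (f : C -> C) :
  aw_op r a b c d (fun w => x * f w) z = x * aw_op r a b c d f z.
Proof. unfold aw_op; ring. Qed.

Lemma aw_op_csum (r a b c d z : C) (f : nat -> C -> C) (n : nat) :
  aw_op r a b c d (fun w => csum (fun j => f j w) n) z =
  csum (fun j => aw_op r a b c d (f j) z) n.
Proof. unfold aw_op; now rewrite csum_minus, !csum_scal. Qed.

Lemma aw_op_ext (r a b c d z : C) (f g : C -> C) :
  r <> 0 -> z <> 0 -> (forall w : C, w <> 0 -> f w = g w) ->
  aw_op r a b c d f z = aw_op r a b c d g z.
Proof.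
  intros Hr Hz E; unfold aw_op; rewrite (E (r * z)), (E (z / r)); trivial.
  - unfold Cdiv; apply Cmult_neq_0; trivial; now apply Cinv_neq_0.
  - now apply Cmult_neq_0.
Qed.

(** The factor [r ^ k] undoes the shift in the prefactor [/ (a r) ^ k], and the [/ a] of
    [aw_op_basis] completes [/ a ^ S k]. *)
Lemma aw_poly_raise (q r : C) (k : nat) (a b c d z : C) :
  q <> 0 -> (forall n, qpoch q q n <> 0) -> r * r = q -> a <> 0 -> z <> 0 ->
  (/ z - z) * aw_poly q (S k) a b c d z =
  r ^ k * aw_op r a b c d (aw_poly q k (a * r) (b * r) (c * r) (d * r)) z.
Proof.
  intros Hq Hqn Hr Ha Hz.
  assert (Hr0 : r <> 0) by (intro E; apply Hq; rewrite <- Hr, E; ring).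
  unfold aw_poly.
  rewrite aw_op_scal, aw_op_csum; symmetry.
  rewrite (csum_ext _ (fun j => (/ z - z) * / a *
    ((1 - a * b * q ^ j) * (1 - a * c * q ^ j) * (1 - a * d * q ^ j) / q ^ j
       * aw_coef q k (a * r) (b * r) (c * r) (d * r) j
       * (qpoch (a * z) q j * qpoch (a / z) q j)
     - (1 - a * b * c * d * q ^ j) / q ^ j
       * aw_coef q k (a * r) (b * r) (c * r) (d * r) j
       * (qpoch (a * z) q (S j) * qpoch (a / z) q (S j))))).
  2:{ intros j _; cbv beta; rewrite aw_op_scal, (aw_op_basis q) by trivial; ring. }
  rewrite csum_scal.
  rewrite (csum_bidiagonal (aw_coef q (S k) a b c d) _ _
             (fun j => qpoch (a * z) q j * qpoch (a / z) q j)).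
  - rewrite Cpow_mult_l, Cpow_S.
    assert (a ^ k <> 0) by now apply Cpow_nz.
    assert (r ^ k <> 0) by now apply Cpow_nz.
    field; auto.
  - rewrite (aw_coef_rec_0 q r) by trivial; simpl; field.
  - intros j Hj; now apply aw_coef_rec.
  - now apply aw_coef_rec_last.
Qed.

(** * Limits of complex sequences *)

Definition clim (u : nat -> C) (l : C) : Prop := filterlim u eventually (locally l).

Lemma clim_Cmod (u : nat -> C) (l : C) :
  clim u l <-> is_lim_seq (fun n => Cmod (u n - l)) 0.
Proof.
  unfold clim.
  rewrite (filterlim_locally_ball_norm (U := C_NormedModule) u l).
  rewrite <- is_lim_seq_spec.
  split; intros H eps; destruct (H eps) as [N HN]; exists N; intros n Hn;
    specialize (HN n Hn).
  - rewrite Rminus_0_r, Rabs_pos_eq by apply Cmod_ge_0; exact HN.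
  - rewrite Rminus_0_r, Rabs_pos_eq in HN by apply Cmod_ge_0; exact HN.
Qed.

Lemma clim_const (l : C) : clim (fun _ => l) l.
Proof. apply filterlim_const. Qed.

Lemma clim_ext_loc (N : nat) (u v : nat -> C) (l : C) :
  (forall n, (N <= n)%nat -> u n = v n) -> clim u l -> clim v l.
Proof. intros E; apply filterlim_ext_loc; now exists N. Qed.

Lemma clim_ext (u v : nat -> C) (l : C) :
  (forall n, u n = v n) -> clim u l -> clim v l.
Proof. intros E; apply (clim_ext_loc 0); auto. Qed.

Lemma clim_unique (u : nat -> C) (x y : C) : clim u x -> clim u y -> x = y.
Proof. apply (filterlim_locally_unique (V := C_NormedModule)). Qed.

Lemma clim_plus (u v : nat -> C) (x y : C) :
  clim u x -> clim v y -> clim (fun n => u n + v n) (x + y).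
Proof.
  intros Hu Hv; eapply filterlim_comp_2; [exact Hu|exact Hv|].
  exact (filterlim_plus (V := C_NormedModule) x y).
Qed.

Lemma is_lim_seq_Cmod (u : nat -> C) (x : C) :
  clim u x -> is_lim_seq (fun n => Cmod (u n)) (Cmod x).
Proof.
  intros H; eapply filterlim_comp; [exact H|].
  apply (filterlim_norm (V := C_NormedModule)).
Qed.

Lemma clim_mult (u v : nat -> C) (x y : C) :
  clim u x -> clim v y -> clim (fun n => u n * v n) (x * y).
Proof.
  intros Hu Hv; assert (Hm := is_lim_seq_Cmod _ _ Hv).
  apply clim_Cmod in Hu; apply clim_Cmod in Hv; apply clim_Cmod.
  apply (is_lim_seq_le_le (fun _ => 0%R) _
    (fun n => Cmod (u n - x) * Cmod (v n) + Cmod x * Cmod (v n - y))%R).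
  - intro n; split; [apply Cmod_ge_0|].
    rewrite <- !Cmod_mult; eapply Rle_trans; [|apply Cmod_triangle].
    right; f_equal; ring.
  - apply is_lim_seq_const.
  - replace 0%R with (0 * Cmod y + Cmod x * 0)%R by ring.
    apply is_lim_seq_plus'; apply is_lim_seq_mult'; trivial; apply is_lim_seq_const.
Qed.

Lemma clim_opp (u : nat -> C) (x : C) : clim u x -> clim (fun n => - u n) (- x).
Proof.
  intros H; apply (clim_ext (fun n => (- (1)) * u n)); [intro; ring|].
  replace (- x) with ((- (1)) * x) by ring.
  apply clim_mult; trivial; apply clim_const.
Qed.

Lemma clim_minus (u v : nat -> C) (x y : C) :
  clim u x -> clim v y -> clim (fun n => u n - v n) (x - y).
Proof. intros Hu Hv; apply clim_plus; trivial; now apply clim_opp. Qed.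

Lemma clim_inv (u : nat -> C) (x : C) :
  x <> 0 -> clim u x -> clim (fun n => / u n) (/ x).
Proof.
  intros Hx Hu; apply clim_Cmod.
  assert (Hm := is_lim_seq_Cmod _ _ Hu).
  assert (Hx0 : (0 < Cmod x)%R) by now apply Cmod_gt_0.
  apply (is_lim_seq_ext_loc
           (fun n => Cmod (u n - x) * (/ Cmod (u n) * / Cmod x))%R).
  - apply is_lim_seq_spec in Hm.
    destruct (Hm (mkposreal _ Hx0)) as [N HN]; exists N; intros n Hn.
    specialize (HN n Hn); simpl in HN.
    assert (Hn0 : u n <> 0).
    { intro E; rewrite E, Cmod_0 in HN; apply Rabs_lt_between in HN; lra. }
    rewrite <- !Cmod_inv, <- !Cmod_mult by trivial.
    replace (/ u n - / x) with (- ((u n - x) * (/ u n * / x))) by (field; auto).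
    now rewrite Cmod_opp.
  - replace 0%R with (0 * (/ Cmod x * / Cmod x))%R by ring.
    apply is_lim_seq_mult'.
    + now apply clim_Cmod.
    + apply is_lim_seq_mult'; [|apply is_lim_seq_const].
      apply (is_lim_seq_inv _ _ Hm); intro E; injection E; lra.
Qed.

Lemma clim_div (u v : nat -> C) (x y : C) :
  y <> 0 -> clim u x -> clim v y -> clim (fun n => u n / v n) (x / y).
Proof. intros Hy Hu Hv; apply clim_mult; trivial; now apply clim_inv. Qed.

Lemma clim_pow (u : nat -> C) (x : C) (k : nat) :
  clim u x -> clim (fun n => u n ^ k) (x ^ k).
Proof.
  intros H; induction k as [|k IH]; [apply clim_const|]; now apply clim_mult.
Qed.

Lemma clim_csum (f : nat -> nat -> C) (g : nat -> C) (k : nat) :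
  (forall j, clim (fun n => f n j) (g j)) -> clim (fun n => csum (f n) k) (csum g k).
Proof.
  intros H; induction k as [|k IH].
  - rewrite csum_0; apply (clim_ext (fun n => f n O)); trivial.
    intro; now rewrite csum_0.
  - rewrite csum_S; apply (clim_ext (fun n => csum (f n) k + f n (S k))).
    + intro; now rewrite csum_S.
    + now apply clim_plus.
Qed.

Lemma clim_qpoch (q : C) (u : nat -> C) (x : C) (k : nat) :
  clim u x -> clim (fun n => qpoch (u n) q k) (qpoch x q k).
Proof.
  intros H; induction k as [|k IH]; [apply clim_const|].
  apply clim_mult; trivial.
  apply clim_minus; [apply clim_const|]; apply clim_mult; trivial; apply clim_const.
Qed.

Lemma clim_subseq (f : nat -> nat) (u : nat -> C) (x : C) :
  (forall N, exists M, forall n, (M <= n)%nat -> (N <= f n)%nat) ->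
  clim u x -> clim (fun n => u (f n)) x.
Proof.
  intros Hf Hu; apply (filterlim_comp _ _ _ f u eventually eventually); trivial.
  intros P [N HN]; destruct (Hf N) as [M HM]; exists M; auto.
Qed.

Lemma clim_bounded (u : nat -> C) (x : C) :
  clim u x -> exists K, forall n, (Cmod (u n) <= K)%R.
Proof.
  intros H.
  destruct (filterlim_bounded (V := C_NormedModule) u) as [K HK]; [now exists x|].
  now exists K.
Qed.

Ltac solve_clim :=
  try assumption;
  lazymatch goal with
  | |- clim (fun _ => ?x) _ => apply (clim_const x)
  | |- clim (fun _ => _ + _) _ => apply clim_plus; solve_clim
  | |- clim (fun _ => _ - _) _ => apply clim_minus; solve_clim
  | |- clim (fun _ => _ * _) _ => apply clim_mult; solve_clim
  | |- clim (fun _ => _ / ?y) _ => apply (clim_mult _ (fun _ => / y)); solve_clim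
  | |- clim (fun _ => _ / _) _ => apply clim_div; solve_clim
  | |- clim (fun _ => _ ^ _) _ => apply clim_pow; solve_clim
  | |- clim (fun _ => qpoch _ _ _) _ => apply clim_qpoch; solve_clim
  | |- clim (fun _ => / _) _ => apply clim_inv; solve_clim
  | _ => idtac
  end.

(** * Continuity and parameter symmetry of the Askey-Wilson polynomials *)

(** Continuity in [z] fills in the points [z = 1] and [z = -1], where the raising formula says
    nothing; continuity in [c] lets [c q^j] tend to zero. *)
Lemma clim_aw_poly (q : C) (k : nat) (a b d : C) (c z : nat -> C) (c' z' : C) :
  z' <> 0 -> clim c c' -> clim z z' ->
  clim (fun n => aw_poly q k a b (c n) d (z n)) (aw_poly q k a b c' d z').
Proof.
  intros Hz Hc Hzz; apply clim_mult; [apply clim_const|].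
  apply clim_csum; intro j; unfold aw_coef; solve_clim.
Qed.

(** Removes the singularities of the divided differences at [z = 1] and [z = -1]. *)
Lemma eq_of_mult_inv_minus (f g : C -> C) (z : C) :
  (forall (u : nat -> C) (w : C), w <> 0 -> clim u w -> clim (fun n => f (u n)) (f w)) ->
  (forall (u : nat -> C) (w : C), w <> 0 -> clim u w -> clim (fun n => g (u n)) (g w)) ->
  (forall w : C, w <> 0 -> (/ w - w) * f w = (/ w - w) * g w) ->
  z <> 0 -> f z = g z.
Proof.
  intros Hf Hg E Hz.
  assert (Hc : forall w : C, w <> 0 -> w * w <> 1 -> f w = g w).
  { intros w Hw Hw1; specialize (E w Hw).
    assert (Hn : / w - w <> 0).
    { intro E'; apply Hw1; replace (w * w) with (1 - w * (/ w - w)) by (field; auto).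
      rewrite E'; ring. }
    replace (f w) with (/ (/ w - w) * ((/ w - w) * f w)) by (field; split; trivial;
      intro E'; apply Hn; replace (/ w - w) with ((1 - w * w) / w) by (field; auto);
      rewrite E'; unfold Cdiv; ring).
    rewrite E; field; split; trivial;
      intro E'; apply Hn; replace (/ w - w) with ((1 - w * w) / w) by (field; auto);
      rewrite E'; unfold Cdiv; ring. }
  destruct (Ceq_dec (z * z) 1) as [Hz1|Hz1]; [|now apply Hc].
  (* Here [z * z = 1], so [u n * u n] is real and greater than 1, and the identity is already known
     at [u n]. *)
  set (u := fun n : nat => z * RtoC (1 + / (INR n + 1))).
  assert (Hu : clim u z).
  { rewrite <- (Cmult_1_r z) at 1; apply clim_mult; [apply clim_const|].
    apply clim_Cmod.
    apply (is_lim_seq_ext (fun n => / (INR n + 1))%R).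
    - intro n; rewrite <- RtoC_minus, Cmod_R.
      assert (0 < / (INR n + 1))%R
        by (apply Rinv_0_lt_compat; assert (H := pos_INR n); lra).
      rewrite Rabs_pos_eq; lra.
    - apply (is_lim_seq_inv _ p_infty); [|easy].
      apply (is_lim_seq_plus _ _ p_infty 1); [apply is_lim_seq_INR|
        apply is_lim_seq_const|easy]. }
  apply (clim_unique (fun n => f (u n))); [now apply Hf|].
  apply (clim_ext (fun n => g (u n))); [|now apply Hg].
  intro n; symmetry; apply Hc.
  - apply Cmult_neq_0; trivial; intro E'; apply RtoC_inj in E'.
    assert (0 < / (INR n + 1))%R
      by (apply Rinv_0_lt_compat; assert (H := pos_INR n); lra); lra.
  - unfold u; intro E'.
    replace (z * RtoC (1 + / (INR n + 1)) * (z * RtoC (1 + / (INR n + 1))))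
      with ((z * z) * (RtoC (1 + / (INR n + 1)) * RtoC (1 + / (INR n + 1)))) in E' by ring.
    rewrite Hz1, Cmult_1_l, <- RtoC_mult in E'; apply RtoC_inj in E'.
    assert (0 < / (INR n + 1))%R
      by (apply Rinv_0_lt_compat; assert (H := pos_INR n); lra); nra.
Qed.

Lemma aw_poly_0 (q a b c d z : C) : aw_poly q 0 a b c d z = 1.
Proof. unfold aw_poly, aw_coef; rewrite csum_0; simpl; field. Qed.

(** Sears' transformation: both sides are produced from [1] by the same iterated
    operators, which are symmetric in the parameters. *)
Lemma aw_poly_sym (q r : C) (k : nat) (a b c d z : C) :
  q <> 0 -> (forall n, qpoch q q n <> 0) -> r * r = q ->
  a <> 0 -> c <> 0 -> z <> 0 ->
  aw_poly q k a b c d z = aw_poly q k c b a d z.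
Proof.
  intros Hq Hqn Hr.
  assert (Hr0 : r <> 0) by (intro E; apply Hq; rewrite <- Hr, E; ring).
  revert a b c d z; induction k as [|k IH]; intros a b c d z Ha Hc Hz.
  { now rewrite !aw_poly_0. }
  apply eq_of_mult_inv_minus; trivial.
  - intros; apply (clim_aw_poly q (S k) a b d (fun _ => c)); trivial; apply clim_const.
  - intros; apply (clim_aw_poly q (S k) c b d (fun _ => a)); trivial; apply clim_const.
  - intros w Hw; rewrite !(aw_poly_raise q r) by trivial; f_equal.
    (* The weight is symmetric in its four parameters; the induction hypothesis then exchanges them
       inside the polynomial. *)
    transitivity (aw_op r c b a d (aw_poly q k (a * r) (b * r) (c * r) (d * r)) w).
    + unfold aw_op, aw_weight, Cdiv; ring.
    + apply aw_op_ext; trivial; intros v Hv; apply IH; trivial; now apply Cmult_neq_0.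
Qed.

(** * The expansion in the basis attached to [c] *)

(** For [i = 0] these are the coefficients [aw_coef q m c b a d j]. The index [i] acts as if every
    parameter were multiplied by [q^(i/2)]. *)
Definition aw_mix_coef (q : C) (i m : nat) (a b c d : C) (j : nat) : C :=
  qpoch (/ q ^ m) q j * qpoch (a * b * c * d / q * q ^ (2 * i + m)) q j * q ^ j
  / qpoch q q j
  * (qpoch (a * c * q ^ (i + j)) q (m - j) * qpoch (b * c * q ^ (i + j)) q (m - j)
     * qpoch (c * d * q ^ (i + j)) q (m - j)).

(** By [(1 - c z) (c z q)_j = (c z)_j (1 - c z q^j)] the basis element passes through the operator
    and leaves [c q^j] in the weight. *)
Lemma aw_op_shift (q r a b c d z : C) (j : nat) (f : C -> C) :
  r <> 0 -> r * r = q -> z <> 0 ->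
  aw_op r a b c d (fun w => qpoch (c * r * w) q j * qpoch (c * r / w) q j * f w) z =
  qpoch (c * z) q j * qpoch (c / z) q j * aw_op r a b (c * q ^ j) d f z.
Proof.
  intros Hr0 Hr Hz; unfold aw_op, aw_weight.
  replace (c * r * (r * z)) with (c * z * q) by (rewrite <- Hr; ring).
  replace (c * r / (r * z)) with (c / z) by (field; auto).
  replace (c * r * (z / r)) with (c * z) by (field; auto).
  replace (c * r / (z / r)) with (c / z * q) by (rewrite <- Hr; field; auto).
  assert (E1 := qpoch_S_l (c * z) q j); assert (E2 := qpoch_S_l (c / z) q j).
  rewrite qpoch_S in E1, E2.
  set (u := f (r * z)); set (v := f (z / r)).
  transitivity (
    (1 - a * z) * (1 - b * z) * (1 - d * z) / (z * z)
      * ((1 - c * z) * qpoch (c * z * q) q j) * qpoch (c / z) q j * u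
    - (1 - a / z) * (1 - b / z) * (1 - d / z) * (z * z)
      * ((1 - c / z) * qpoch (c / z * q) q j) * qpoch (c * z) q j * v).
  { field; auto. }
  rewrite <- E1, <- E2; field; auto.
Qed.

(** Expansion interpolating between the trivial one ([m = 0]) and the hypergeometric
    one in the parameter [c] ([i = 0]); the polynomials of degree [i] in it converge
    as [j] grows. *)
Lemma aw_poly_mix (q r : C) (i m : nat) (a b c d z : C) :
  q <> 0 -> (forall n, qpoch q q n <> 0) -> r * r = q ->
  a <> 0 -> c <> 0 -> z <> 0 ->
  aw_poly q (i + m) a b c d z =
  / c ^ m * csum (fun j => aw_mix_coef q i m a b c d j
    * (qpoch (c * z) q j * qpoch (c / z) q j * aw_poly q i a b (c * q ^ j) d z)) m.
Proof.
  intros Hq Hqn Hr.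
  assert (Hr0 : r <> 0) by (intro E; apply Hq; rewrite <- Hr, E; ring).
  revert a b c d z; induction i as [|i IH]; intros a b c d z Ha Hc Hz.
  { simpl Nat.add; rewrite (aw_poly_sym q r) by trivial.
    unfold aw_poly at 1; f_equal; apply csum_ext; intros j _.
    rewrite aw_poly_0; unfold aw_coef, aw_mix_coef.
    replace (c * b * a * d) with (a * b * c * d) by ring.
    replace (c * b) with (b * c) by ring; replace (c * a) with (a * c) by ring.
    simpl Nat.mul; simpl Nat.add; ring. }
  apply (eq_of_mult_inv_minus (aw_poly q (S i + m) a b c d)
    (fun z => / c ^ m * csum (fun j => aw_mix_coef q (S i) m a b c d j
      * (qpoch (c * z) q j * qpoch (c / z) q j * aw_poly q (S i) a b (c * q ^ j) d z)) m));
    trivial.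
  - intros; apply (clim_aw_poly q (S i + m) a b d (fun _ => c)); trivial;
      apply clim_const.
  - intros u w Hw Hu; apply clim_mult; [apply clim_const|].
    apply clim_csum; intro j; solve_clim.
    apply (clim_aw_poly q (S i) a b d (fun _ => c * q ^ j)); trivial; apply clim_const.
  - clear z Hz; intros z Hz.
    rewrite (Nat.add_succ_l i m), (aw_poly_raise q r) by trivial.
    rewrite (aw_op_ext r a b c d z _ (fun w => / (c * r) ^ m * csum (fun j =>
      aw_mix_coef q i m (a * r) (b * r) (c * r) (d * r) j
      * (qpoch (c * r * w) q j * qpoch (c * r / w) q j
         * aw_poly q i (a * r) (b * r) (c * q ^ j * r) (d * r) w)) m)); trivial.
    2:{ intros w Hw; rewrite IH by (trivial; now apply Cmult_neq_0).
        f_equal; apply csum_ext; intros j _.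
        now replace (c * r * q ^ j) with (c * q ^ j * r) by ring. }
    rewrite aw_op_scal, aw_op_csum, <- !csum_scal; apply csum_ext; intros j _.
    cbv beta; rewrite aw_op_scal, (aw_op_shift q) by trivial.
    transitivity (aw_mix_coef q (S i) m a b c d j / c ^ m
      * (qpoch (c * z) q j * qpoch (c / z) q j)
      * ((/ z - z) * aw_poly q (S i) a b (c * q ^ j) d z)); [|unfold Cdiv; ring].
    rewrite (aw_poly_raise q r) by trivial.
    (* Multiplying all parameters by [r] amounts to raising [i]: a product of two gains [q], the
       product of four gains [q^2]. This is why the coefficients survive the induction. *)
    assert (E : aw_mix_coef q i m (a * r) (b * r) (c * r) (d * r) j
                = aw_mix_coef q (S i) m a b c d j).
    { unfold aw_mix_coef.
      assert (F : forall x y, x * r * (y * r) * q ^ (i + j) = x * y * q ^ (S i + j))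
        by (intros; rewrite Nat.add_succ_l, Cpow_S, <- Hr; ring).
      rewrite !F.
      replace (a * r * (b * r) * (c * r) * (d * r) / q * q ^ (2 * i + m))
        with (a * b * c * d / q * q ^ (2 * S i + m)); [easy|].
      replace (2 * S i + m)%nat with (S (S (2 * i + m))) by lia.
      rewrite !Cpow_S, <- Hr; field; trivial. }
    rewrite E, Cpow_mult_l, Cpow_add_r.
    assert (c ^ m <> 0) by now apply Cpow_nz.
    assert (r ^ m <> 0) by now apply Cpow_nz.
    field; auto.
Qed.

(** * Partial sums of the series attached to one basis element *)

Lemma binom2_S (k : nat) : binom2 (S k) = (binom2 k + k)%nat.
Proof.
  unfold binom2; rewrite Nat.sub_succ, Nat.sub_0_r.
  destruct k as [|k]; [easy|].
  rewrite Nat.sub_succ, Nat.sub_0_r.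
  replace (S (S k) * S k)%nat with (S k * k + S k * 2)%nat by lia.
  now rewrite Nat.div_add.
Qed.

Lemma Cpow_m1_sqr (k : nat) : (- (1)) ^ k * (- (1)) ^ k = 1.
Proof.
  rewrite <- Cpow_mult_l; replace (- (1) * - (1)) with (RtoC 1) by ring.
  apply Cpow_1_l.
Qed.

(** Reversal of the product [(q^-(i+m))_i], multiplied out to avoid division. The power
    [q ^ binom2 (i + m)] on the left is the one carried by the term of the series. *)
Lemma qpoch_inv_pow_add (q : C) (i m : nat) :
  q <> 0 ->
  q ^ binom2 (i + m) * qpoch (/ q ^ (i + m)) q i * qpoch q q m * q ^ i =
  (- (1)) ^ i * q ^ binom2 m * qpoch q q (i + m).
Proof.
  intros Hq; induction i as [|i IH]; [simpl; ring|].
  rewrite Nat.add_succ_l, binom2_S, Cpow_add_r, qpoch_inv_pow_S, !Cpow_S by trivial.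
  rewrite (qpoch_S q q (i + m)).
  transitivity ((- (1)) * (1 - q * q ^ (i + m))
    * (q ^ binom2 (i + m) * qpoch (/ q ^ (i + m)) q i * qpoch q q m * q ^ i)).
  - assert (q ^ (i + m) <> 0) by now apply Cpow_nz.
    field; auto.
  - rewrite IH; ring.
Qed.

(** The [k]-th term of the series, with the dual polynomial replaced by the [i]-th
    element of the basis in which it is expanded. *)
Definition aw_term (q : C) (i : nat) (a b c d z : C) (k : nat) : C :=
  q ^ binom2 k * (- c) ^ k
  * (qpoch (a * b * c * d / q) q k * (1 - a * b * c * d / q * q ^ (2 * k))
     / (1 - a * b * c * d / q)
     / (qpoch q q k * (qpoch (a * c) q k * qpoch (b * c) q k * qpoch (c * d) q k)))
  * (qpoch (/ q ^ k) q i * qpoch (a * b * c * d / q * q ^ k) q i)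
  * aw_poly q k a b c d z.

(** The part of the expanded term that depends on [j] but not on the degree; it converges as [j]
    grows. *)
Definition aw_limit_coef (q : C) (i : nat) (a b c d z : C) (j : nat) : C :=
  qpoch (c * z) q j * qpoch (c / z) q j * aw_poly q i a b (c * q ^ j) d z
  / (qpoch q q j
     * (qpoch (a * c) q (i + j) * qpoch (b * c) q (i + j) * qpoch (c * d) q (i + j))).

(** The terms of Euler's expansion of [(t; q)_oo] at [t = q], which turns the exponent [binom2 l]
    into [binom2 (S l)]. *)
Definition euler_coef (q : C) (l : nat) : C :=
  (- (1)) ^ l * q ^ binom2 (S l) / qpoch q q l.

Lemma qpoch_add_neq_0 (x q : C) (m n : nat) :
  qpoch x q (m + n) <> 0 -> qpoch x q m <> 0 /\ qpoch (x * q ^ m) q n <> 0.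
Proof.
  rewrite qpoch_add; intros H; split; intro E; apply H; rewrite E; ring.
Qed.

(** In [aw_poly_mix], the reversals of [(q^-(i+m))_i] and [(q^-m)_j] leave only
    [q ^ binom2 l / (q)_l] with [l = m - j], and the three products starting from [abcd/q] join end
    to end into a single one of length [2 (i + j) + l]. *)
Lemma aw_term_expand (q r : C) (i m : nat) (a b c d z : C) :
  q <> 0 -> (forall n, qpoch q q n <> 0) -> r * r = q ->
  a <> 0 -> c <> 0 -> z <> 0 -> 1 - a * b * c * d / q <> 0 ->
  (forall n, qpoch (a * c) q n <> 0) -> (forall n, qpoch (b * c) q n <> 0) ->
  (forall n, qpoch (c * d) q n <> 0) ->
  aw_term q i a b c d z (i + m) =
  c ^ i / q ^ i * csum (fun j => aw_limit_coef q i a b c d z j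
    * ((- (1)) ^ (m - j) * q ^ binom2 (m - j)
       * (qpoch (a * b * c * d / q) q (2 * (i + j) + (m - j))
          * (1 - a * b * c * d / q * q ^ (2 * (i + m))) / (1 - a * b * c * d / q))
       / qpoch q q (m - j))) m.
Proof.
  intros Hq Hqn Hr Ha Hc Hz HE Hac Hbc Hcd.
  unfold aw_term; rewrite (aw_poly_mix q r) by trivial.
  rewrite <- !csum_scal; apply csum_ext; intros j Hj.
  set (l := (m - j)%nat).
  assert (Hm : m = (j + l)%nat) by lia.
  unfold aw_mix_coef, aw_limit_coef; fold l.
  set (e := a * b * c * d / q) in *.
  assert (A1 := qpoch_inv_pow_add q i m Hq).
  assert (A2 := qpoch_inv_pow_add q j l Hq); rewrite <- Hm in A2.
  assert (P1 : qpoch e q (2 * (i + j) + l) =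
    qpoch e q (i + m) * qpoch (e * q ^ (i + m)) q i * qpoch (e * q ^ (2 * i + m)) q j).
  { rewrite <- qpoch_add; replace (2 * i + m)%nat with (i + m + i)%nat by lia.
    rewrite <- qpoch_add; f_equal; lia. }
  assert (Q : forall x, qpoch x q (i + m) = qpoch x q (i + j) * qpoch (x * q ^ (i + j)) q l).
  { intro x; rewrite <- qpoch_add; f_equal; lia. }
  assert (N1 := qpoch_add_neq_0 _ _ (i + j) l (Hac _)).
  assert (N2 := qpoch_add_neq_0 _ _ (i + j) l (Hbc _)).
  assert (N3 := qpoch_add_neq_0 _ _ (i + j) l (Hcd _)).
  rewrite P1, !Q, Cpow_add_r.
  replace ((- c) ^ i) with ((- (1)) ^ i * c ^ i)
    by (rewrite <- Cpow_mult_l; f_equal; ring).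
  replace ((- c) ^ m) with ((- (1)) ^ j * (- (1)) ^ l * c ^ m)
    by (rewrite <- Cpow_add_r, <- Hm, <- Cpow_mult_l; f_equal; ring).
  assert (S1 := Cpow_m1_sqr i); assert (S2 := Cpow_m1_sqr j).
  assert (M0 := Hqn m); assert (L0 := Hqn l); assert (I0 := Hqn (i + m)%nat).
  rewrite <- Q.
  assert (J0 := Hqn j).
  assert (Qi : q ^ i <> 0) by now apply Cpow_nz.
  assert (Qj : q ^ j <> 0) by now apply Cpow_nz.
  assert (Cm : c ^ m <> 0) by now apply Cpow_nz.
  assert (B1 : q ^ binom2 (i + m) * qpoch (/ q ^ (i + m)) q i =
    (- (1)) ^ i * (q ^ binom2 m / qpoch q q m) * qpoch q q (i + m) / q ^ i).
  { rewrite <- (Cmult_1_r (q ^ binom2 (i + m) * _)).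
    replace (RtoC 1) with (qpoch q q m * q ^ i * / (qpoch q q m * q ^ i)) at 1
      by (field; auto).
    rewrite Cmult_assoc, Cmult_assoc, A1; field; auto. }
  assert (B2 : q ^ binom2 m / qpoch q q m * qpoch (/ q ^ m) q j =
    (- (1)) ^ j * q ^ binom2 l / (qpoch q q l * q ^ j)).
  { transitivity (q ^ binom2 m * qpoch (/ q ^ m) q j * qpoch q q l * q ^ j
      / (qpoch q q m * (qpoch q q l * q ^ j))); [field; auto|].
    rewrite A2; field; auto. }
  set (sm := q ^ binom2 m / qpoch q q m) in *.
  transitivity (
    (q ^ binom2 (i + m) * qpoch (/ q ^ (i + m)) q i)
    * ((- (1)) ^ i * c ^ i * ((- (1)) ^ j * (- (1)) ^ l * c ^ m))
    * (qpoch e q (i + m) * (1 - e * q ^ (2 * (i + m))) / (1 - e)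
       / (qpoch q q (i + m) *
        (qpoch (a * c) q (i + j) * qpoch (a * c * q ^ (i + j)) q l *
         (qpoch (b * c) q (i + j) * qpoch (b * c * q ^ (i + j)) q l) *
         (qpoch (c * d) q (i + j) * qpoch (c * d * q ^ (i + j)) q l))))
    * qpoch (e * q ^ (i + m)) q i
    * (/ c ^ m *
     (qpoch (/ q ^ m) q j * qpoch (e * q ^ (2 * i + m)) q j * q ^ j / qpoch q q j *
      (qpoch (a * c * q ^ (i + j)) q l * qpoch (b * c * q ^ (i + j)) q l *
       qpoch (c * d * q ^ (i + j)) q l) *
      (qpoch (c * z) q j * qpoch (c / z) q j * aw_poly q i a b (c * q ^ j) d z)))).
  { rewrite (Q q); unfold Cdiv; ring. }
  rewrite B1.
  transitivity (
    (sm * qpoch (/ q ^ m) q j) * ((- (1)) ^ i * (- (1)) ^ i) * (- (1)) ^ j * (- (1)) ^ l * c ^ i / q ^ i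
    * (qpoch e q (i + m) * (1 - e * q ^ (2 * (i + m))) / (1 - e)
       / (qpoch (a * c) q (i + j) * qpoch (b * c) q (i + j) * qpoch (c * d) q (i + j)))
    * qpoch (e * q ^ (i + m)) q i
    * (qpoch (e * q ^ (2 * i + m)) q j * q ^ j / qpoch q q j *
      (qpoch (c * z) q j * qpoch (c / z) q j * aw_poly q i a b (c * q ^ j) d z))).
  { field; repeat split; tauto. }
  rewrite B2, S1.
  transitivity (
    ((- (1)) ^ j * (- (1)) ^ j) * q ^ binom2 l / qpoch q q l * (- (1)) ^ l * c ^ i / q ^ i
    * (qpoch e q (i + m) * (1 - e * q ^ (2 * (i + m))) / (1 - e)
       / (qpoch (a * c) q (i + j) * qpoch (b * c) q (i + j) * qpoch (c * d) q (i + j)))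
    * qpoch (e * q ^ (i + m)) q i
    * (qpoch (e * q ^ (2 * i + m)) q j / qpoch q q j *
      (qpoch (c * z) q j * qpoch (c / z) q j * aw_poly q i a b (c * q ^ j) d z))).
  { field; repeat split; tauto. }
  rewrite S2; field; repeat split; tauto.
Qed.

Lemma csum_zero (u : nat -> C) (n : nat) :
  (forall k, (k <= n)%nat -> u k = 0) -> csum u n = 0.
Proof.
  intros H; rewrite (csum_ext _ (fun _ => 0 * 0)) by (intros; rewrite H by trivial; ring).
  rewrite csum_scal; ring.
Qed.

(** For each [j], the term of degree [i + S M] is the difference of two consecutive values of the
    closed form. With [e = abcd/q], [n = 2 (i + j)] and [l = M - j] this comes down to [q^(l+1) (1 -
    e q^(n+l+1)) + (1 - q^(l+1)) = 1 - e q^(n+2l+2)]. *)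
Lemma csum_aw_term (q r : C) (i M : nat) (a b c d z : C) :
  q <> 0 -> (forall n, qpoch q q n <> 0) -> r * r = q ->
  a <> 0 -> c <> 0 -> z <> 0 -> 1 - a * b * c * d / q <> 0 ->
  (forall n, qpoch (a * c) q n <> 0) -> (forall n, qpoch (b * c) q n <> 0) ->
  (forall n, qpoch (c * d) q n <> 0) ->
  csum (aw_term q i a b c d z) (i + M) =
  c ^ i / q ^ i * csum (fun j => aw_limit_coef q i a b c d z j
    * (euler_coef q (M - j) * qpoch (a * b * c * d) q (2 * (i + j) + (M - j)))) M.
Proof.
  intros Hq Hqn Hr Ha Hc Hz HE Hac Hbc Hcd.
  assert (Hsh : forall n, qpoch (a * b * c * d / q) q (S n) / (1 - a * b * c * d / q)
                          = qpoch (a * b * c * d) q n).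
  { intro n; rewrite qpoch_S_l.
    replace (a * b * c * d / q * q) with (a * b * c * d) by (field; trivial).
    field; split; trivial; intro E; apply HE.
    replace (1 - a * b * c * d / q) with ((q - a * b * c * d) / q) by (field; trivial).
    rewrite E; unfold Cdiv; ring. }
  induction M as [|M IH].
  - assert (E : csum (aw_term q i a b c d z) (i + 0) = aw_term q i a b c d z (i + 0)).
    (* The terms with [k < i] vanish together with [(q^-k)_i]. *)
    { rewrite !Nat.add_0_r; destruct i as [|i]; [apply csum_0|].
      rewrite csum_S, csum_zero; [ring|].
      intros k Hk; unfold aw_term.
      rewrite (qpoch_inv_pow q k (S i)) by (trivial; lia); ring. }
    rewrite E, (aw_term_expand q r), !csum_0 by trivial; f_equal; f_equal.
    unfold euler_coef; simpl Nat.sub; rewrite !Nat.add_0_r, <- Hsh, qpoch_S.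
    simpl; unfold Cdiv; ring.
  - assert (E0 : csum (fun j => aw_limit_coef q i a b c d z j
      * ((- (1)) ^ (S M - j) * q ^ binom2 (S M - j)
         * (qpoch (a * b * c * d / q) q (2 * (i + j) + (S M - j))
            * (1 - a * b * c * d / q * q ^ (2 * (i + S M))) / (1 - a * b * c * d / q))
         / qpoch q q (S M - j))) (S M) =
      csum (fun j => aw_limit_coef q i a b c d z j
        * (euler_coef q (S M - j) * qpoch (a * b * c * d) q (2 * (i + j) + (S M - j))))
        (S M)
      - csum (fun j => aw_limit_coef q i a b c d z j
        * (euler_coef q (M - j) * qpoch (a * b * c * d) q (2 * (i + j) + (M - j)))) M).
    { rewrite !csum_S, !Nat.sub_diag, !Nat.add_0_r.
      match goal with |- ?x + ?y = ?x' + ?y' - ?x'' =>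
        enough (Ex : x = x' - x''); [enough (Ey : y = y'); [rewrite Ex, Ey; ring|]|] end.
      - unfold euler_coef; rewrite <- Hsh, (qpoch_S _ q (2 * (i + S M))).
        simpl binom2; simpl Cpow at 1 2 5; unfold Cdiv; ring.
      - rewrite <- csum_minus; apply csum_ext; intros j Hj.
        replace (S M - j)%nat with (S (M - j)) by lia.
        set (l := (M - j)%nat); replace (i + S M)%nat with (i + j + S l)%nat by lia.
        match goal with |- ?x * _ = ?x * ?u - ?x * ?v =>
          replace (x * u - x * v) with (x * (u - v)) by ring end; f_equal.
        rewrite !Nat.add_succ_r, <- !Hsh, !qpoch_S.
        unfold euler_coef; rewrite !binom2_S, !qpoch_S.
        replace (2 * S (i + j + l))%nat with (2 * (i + j) + l + l + 2)%nat by lia.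
        replace (a * b * c * d / q * q ^ (2 * (i + j) + l + l + 2)) with
          (a * b * c * d / q * (q ^ (2 * (i + j) + l) * q ^ l * (q * q)))
          by (rewrite !Cpow_add_r; simpl; ring).
        assert (L0 := Hqn l); assert (L1 := Hqn (S l)); rewrite qpoch_S in L1.
        assert (1 - q * q ^ l <> 0) by (intro E; apply L1; rewrite E; ring).
        rewrite !Cpow_S, !Cpow_add_r, !Cpow_S.
        set (e := a * b * c * d / q) in *.
        field; auto. }
    rewrite Nat.add_succ_r, csum_S, IH, <- Nat.add_succ_r, (aw_term_expand q r), E0
      by trivial; ring.
Qed.

(** * Tannery's theorem *)

Lemma csum_Cmod_le (u : nat -> C) (v : nat -> R) (L M : nat) (B : R) :
  (L <= M)%nat -> (forall l, (l <= M)%nat -> (Cmod (u l) <= B * v l)%R) ->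
  (Cmod (csum u M) <= Cmod (csum u L) + B * (sum_n v M - sum_n v L))%R.
Proof.
  intros HL; induction HL as [|M HL IH]; intros H.
  - right; ring.
  - rewrite csum_S; eapply Rle_trans; [apply Cmod_triangle|].
    rewrite sum_Sn; change plus with Rplus.
    assert (H1 := H (S M) (Nat.le_refl _)).
    assert (H2 : (Cmod (csum u M) <= Cmod (csum u L) + B * (sum_n v M - sum_n v L))%R)
      by (apply IH; intros; apply H; lia).
    nra.
Qed.

(** The length of the sum grows together with the parameter [M]. After subtracting [x] from [h M l],
    the head up to a fixed [L] tends to zero termwise, and the rest is dominated by a tail of the
    series of [Cmod (v l)]. *)
Lemma clim_tannery (v : nat -> C) (h : nat -> nat -> C) (V x : C) (K : R) :
  ex_series (fun l => Cmod (v l)) -> clim (csum v) V ->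
  (forall l, clim (fun M => h M l) x) ->
  (forall M l, (l <= M)%nat -> (Cmod (h M l) <= K)%R) ->
  clim (fun M => csum (fun l => v l * h M l) M) (V * x).
Proof.
  intros [S HS] HV Hh HK.
  apply (clim_ext (fun M => csum (fun l => v l * (h M l - x)) M + csum v M * x)).
  { intro M; rewrite (Cmult_comm (csum v M)), <- csum_scal.
    rewrite (csum_ext (fun l => v l * (h M l - x)) (fun l => v l * h M l - x * v l))
      by (intros; ring).
    rewrite csum_minus; ring. }
  replace (V * x) with (0 + V * x) by ring.
  apply clim_plus; [|apply clim_mult; [trivial|apply clim_const]].
  set (B := (Rmax 0 K + Cmod x)%R).
  assert (HB : (0 <= B)%R)
    by (unfold B; assert (H := Cmod_ge_0 x); assert (H' := Rmax_l 0 K); lra).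
  apply clim_Cmod, is_lim_seq_spec; intros eps.
  assert (He := cond_pos eps).
  assert (HT : is_lim_seq (sum_n (fun l => Cmod (v l))) S) by exact HS.
  apply is_lim_seq_spec in HT.
  (* Two partial sums within this distance of [S] differ by at most twice it, so the tail costs at
     most [eps / 2]; [B + 1] keeps the denominator positive. *)
  assert (Hd : (0 < eps / (4 * (B + 1)))%R) by (apply Rdiv_lt_0_compat; lra).
  destruct (HT (mkposreal _ Hd)) as [L HL]; simpl in HL.
  assert (H0 : clim (fun M => csum (fun l => v l * (h M l - x)) L) 0).
  { replace (RtoC 0) with (csum (fun l => v l * (x - x)) L)
      by (rewrite (csum_ext _ (fun _ => 0 * 0)) by (intros; ring);
          rewrite csum_scal; ring).
    apply clim_csum; intro j; solve_clim; apply Hh. }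
  apply clim_Cmod, is_lim_seq_spec in H0.
  assert (He2 : (0 < eps / 2)%R) by lra.
  destruct (H0 (mkposreal _ He2)) as [N HN]; simpl in HN.
  exists (max N L); intros M HM.
  specialize (HN M ltac:(lia)).
  rewrite Rminus_0_r, Rabs_pos_eq in HN by apply Cmod_ge_0.
  rewrite Rminus_0_r, Rabs_pos_eq by apply Cmod_ge_0.
  replace (csum (fun l => v l * (h M l - x)) L - 0)
    with (csum (fun l => v l * (h M l - x)) L) in HN by ring.
  replace (csum (fun l => v l * (h M l - x)) M - 0)
    with (csum (fun l => v l * (h M l - x)) M) by ring.
  eapply Rle_lt_trans.
  - apply (csum_Cmod_le _ (fun l => Cmod (v l)) L M B); [lia|].
    intros l Hl; rewrite Cmod_mult, Rmult_comm.
    apply Rmult_le_compat_r; [apply Cmod_ge_0|].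
    eapply Rle_trans; [apply Cmod_triangle|]; rewrite Cmod_opp; unfold B.
    assert (H1 := HK M l Hl); assert (H2 := Rmax_r 0 K); lra.
  - assert (T1 := HL L ltac:(lia)); assert (T2 := HL M ltac:(lia)).
    apply Rabs_lt_between in T1; apply Rabs_lt_between in T2.
    set (tM := sum_n (fun l => Cmod (v l)) M) in *.
    set (tL := sum_n (fun l => Cmod (v l)) L) in *.
    assert (Hq : (B * (tM - tL) <= (B + 1) * (2 * (eps / (4 * (B + 1)))))%R).
    { apply Rle_trans with (B * (2 * (eps / (4 * (B + 1)))))%R.
      - apply Rmult_le_compat_l; lra.
      - apply Rmult_le_compat_r; lra. }
    replace ((B + 1) * (2 * (eps / (4 * (B + 1)))))%R with (eps / 2)%R in Hq
      by (field; lra).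
    lra.
Qed.

Lemma ex_clim_csum (u : nat -> C) :
  ex_series (fun k => Cmod (u k)) -> exists l, clim (csum u) l.
Proof.
  intros H.
  destruct (ex_series_le (V := C_CompleteNormedModule) u (fun k => Cmod (u k)))
    as [l Hl]; trivial.
  - intro; apply Rle_refl.
  - now exists l.
Qed.

Lemma ex_series_Cmod_geom (u : nat -> C) (q K : R) :
  (0 < q < 1)%R -> (forall k, (Cmod (u k) <= K * q ^ k)%R) ->
  ex_series (fun k => Cmod (u k)).
Proof.
  intros Hq H.
  apply (ex_series_le (K := R_AbsRing) (V := R_CompleteNormedModule) _
           (fun k => scal K (q ^ k)%R)).
  - intro k; change (Rabs (Cmod (u k)) <= K * q ^ k)%R.
    rewrite Rabs_pos_eq; [apply H|apply Cmod_ge_0].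
  - apply (ex_series_scal (V := R_NormedModule)); apply ex_series_geom.
    rewrite Rabs_pos_eq; lra.
Qed.

(** * Convergence and nonvanishing of infinite q-products *)

(** Each factor satisfies [|1 - a q^k| <= 1 + |a| q^k <= exp (|a| q^k)], and the exponents form a
    geometric sum. *)
Lemma Cmod_qpoch_le (a : C) (q : R) (n : nat) : (0 < q < 1)%R ->
  (Cmod (qpoch a q n) <= exp (Cmod a * ((1 - q ^ n) / (1 - q))))%R.
Proof.
  intros Hq; induction n as [|n IH].
  - simpl; rewrite Cmod_1, Rminus_diag.
    replace (Cmod a * (0 / (1 - q)))%R with 0%R by (field; lra).
    rewrite exp_0; lra.
  - rewrite qpoch_S, Cmod_mult.
    replace (Cmod a * ((1 - q ^ S n) / (1 - q)))%R
      with (Cmod a * ((1 - q ^ n) / (1 - q)) + Cmod a * q ^ n)%R by (simpl; field; lra).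
    rewrite exp_plus; apply Rmult_le_compat; trivial; try apply Cmod_ge_0.
    eapply Rle_trans; [apply Cmod_triangle|].
    rewrite Cmod_1, Cmod_opp, Cmod_mult, <- RtoC_pow, Cmod_R.
    rewrite (Rabs_pos_eq (q ^ n)) by (apply pow_le; lra).
    apply exp_ineq1_le.
Qed.

(** Consecutive products differ by [(a)_k a q^k], which is geometrically small since the products
    are bounded. The limit thus exists, and [CLim_seq] takes its intended value. *)
Lemma clim_qpoch_inf (a : C) (q : R) : (0 < q < 1)%R ->
  clim (qpoch a q) (qpoch_inf a q).
Proof.
  intros Hq.
  assert (Hl : exists l, clim (csum (fun k => qpoch a q (S k) - qpoch a q k)) l).
  { apply ex_clim_csum.
    apply (ex_series_Cmod_geom _ q (exp (Cmod a * (1 / (1 - q))) * Cmod a)); trivial.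
    intro k; rewrite qpoch_S.
    replace (qpoch a q k * (1 - a * RtoC q ^ k) - qpoch a q k)
      with (- (qpoch a q k * (a * RtoC q ^ k))) by ring.
    assert (Hk : (0 < q ^ k)%R) by (apply pow_lt; lra).
    rewrite Cmod_opp, !Cmod_mult, <- RtoC_pow, Cmod_R, (Rabs_pos_eq (q ^ k)) by lra.
    rewrite <- Rmult_assoc; apply Rmult_le_compat_r; [lra|].
    apply Rmult_le_compat_r; [apply Cmod_ge_0|].
    eapply Rle_trans; [now apply Cmod_qpoch_le|].
    assert (Hle : (Cmod a * ((1 - q ^ k) / (1 - q)) <= Cmod a * (1 / (1 - q)))%R).
    { apply Rmult_le_compat_l; [apply Cmod_ge_0|].
      apply Rmult_le_compat_r; [left; apply Rinv_0_lt_compat|]; lra. }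
    destruct Hle as [Hle| ->]; [left; now apply exp_increasing|right; reflexivity]. }
  destruct Hl as [l Hl].
  assert (H : clim (qpoch a q) (l + 1)).
  { apply (clim_ext_loc 1 (fun n => csum (fun k => qpoch a q (S k) - qpoch a q k) (n - 1) + 1)).
    - intros [|n] Hn; [lia|]; simpl Nat.sub; rewrite Nat.sub_0_r; clear Hn.
      induction n as [|n IH]; [rewrite csum_0; simpl; ring|].
      rewrite csum_S; transitivity (qpoch a q (S n) + (qpoch a q (S (S n)) - qpoch a q (S n)));
        [rewrite <- IH|]; ring.
    - apply clim_plus; [|apply clim_const].
      apply (clim_subseq (fun n => n - 1)%nat (csum _)); trivial.
      intro N; exists (S N); lia. }
  unfold qpoch_inf; now rewrite (CLim_seq_unique _ _ H).
Qed.

(** Weierstrass's inequality: a product of factors [1 - x_k] with [0 <= x_k <= 1] is at least 1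
    minus the sum of the [x_k]. *)
Lemma Cmod_qpoch_ge (a : C) (q : R) (n : nat) : (0 < q < 1)%R ->
  (Cmod a <= 1)%R -> (1 - Cmod a / (1 - q) <= Cmod (qpoch a q n))%R.
Proof.
  intros Hq Ha.
  assert (H0 := Cmod_ge_0 a).
  enough (H : (1 - Cmod a * ((1 - q ^ n) / (1 - q)) <= Cmod (qpoch a q n))%R).
  { eapply Rle_trans; [|exact H].
    apply Rplus_le_compat_l, Ropp_le_contravar, Rmult_le_compat_l; trivial.
    rewrite <- (Rmult_1_l (/ (1 - q))).
    apply Rmult_le_compat_r; [left; apply Rinv_0_lt_compat; lra|].
    assert (0 < q ^ n)%R by (apply pow_lt; lra); lra. }
  induction n as [|n IH].
  - simpl; rewrite Cmod_1, Rminus_diag; unfold Rdiv; lra.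
  - rewrite qpoch_S, Cmod_mult.
    assert (Hn : (0 < q ^ n <= 1)%R).
    { split; [apply pow_lt; lra|]; rewrite <- (pow1 n); apply pow_incr; lra. }
    assert (H1 : (1 - Cmod a * q ^ n <= Cmod (1 - a * RtoC q ^ n))%R).
    { assert (T := Cmod_triangle (1 - a * RtoC q ^ n) (a * RtoC q ^ n)).
      replace (1 - a * RtoC q ^ n + a * RtoC q ^ n) with (RtoC 1) in T by ring.
      rewrite Cmod_1, (Cmod_mult a), <- RtoC_pow, Cmod_R, Rabs_pos_eq in T by lra.
      rewrite <- RtoC_pow; lra. }
    replace ((1 - q ^ S n) / (1 - q))%R with ((1 - q ^ n) / (1 - q) + q ^ n)%R
      by (simpl; field; lra).
    assert (Hs : (0 <= (1 - q ^ n) / (1 - q))%R)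
      by (apply Rmult_le_pos; [lra|left; apply Rinv_0_lt_compat; lra]).
    set (s := ((1 - q ^ n) / (1 - q))%R) in *.
    set (p := Cmod (qpoch a q n)) in *.
    assert (Hp : (0 <= p)%R) by apply Cmod_ge_0.
    assert (Ht : (0 <= 1 - Cmod a * q ^ n)%R).
    { assert (H2 : (Cmod a * q ^ n <= 1 * 1)%R) by (apply Rmult_le_compat; lra); lra. }
    apply Rle_trans with (p * (1 - Cmod a * q ^ n))%R; [|now apply Rmult_le_compat_l].
    apply Rle_trans with ((1 - Cmod a * s) * (1 - Cmod a * q ^ n))%R;
      [|now apply Rmult_le_compat_r].
    assert (0 <= (Cmod a * s) * (Cmod a * q ^ n))%R
      by (apply Rmult_le_pos; apply Rmult_le_pos; trivial; lra).
    nra.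
Qed.

(** Beyond an index [N] with [|a| q^N <= (1 - q) / 2] the remaining products have modulus at least
    1/2, so only the first [N] factors could make the limit vanish. *)
Lemma qpoch_inf_neq_0 (a : C) (q : R) : (0 < q < 1)%R ->
  (forall n, qpoch a q n <> 0) -> qpoch_inf a q <> 0.
Proof.
  intros Hq Hn.
  assert (HN : exists N, (Cmod a * q ^ N <= (1 - q) / 2)%R).
  { assert (H : is_lim_seq (fun n => Cmod a * q ^ n)%R (Cmod a * 0)%R).
    { apply is_lim_seq_mult'; [apply is_lim_seq_const|].
      apply is_lim_seq_geom; rewrite Rabs_pos_eq; lra. }
    rewrite Rmult_0_r in H; apply is_lim_seq_spec in H.
    assert (Hp : (0 < (1 - q) / 2)%R) by lra.
    destruct (H (mkposreal _ Hp)) as [N HN]; exists N; simpl in HN.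
    specialize (HN N (Nat.le_refl _)); apply Rabs_lt_between in HN; lra. }
  destruct HN as [N HN].
  assert (HN' : (Cmod (a * RtoC q ^ N) <= (1 - q) / 2)%R)
    by (rewrite Cmod_mult, <- RtoC_pow, Cmod_R, Rabs_pos_eq; [trivial|apply pow_le; lra]).
  intro E.
  assert (H1 : clim (fun n => qpoch a q (N + n)) 0).
  { rewrite <- E; apply (clim_subseq (fun n => N + n)%nat); [|now apply clim_qpoch_inf].
    intro M; exists M; lia. }
  assert (H2 : clim (fun n => / qpoch a q N * qpoch a q (N + n)) (/ qpoch a q N * 0))
    by (apply clim_mult; [apply clim_const|trivial]).
  apply is_lim_seq_Cmod in H2; rewrite Cmult_0_r, Cmod_0 in H2.
  apply is_lim_seq_spec in H2.
  assert (Hp : (0 < 1 / 2)%R) by lra.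
  destruct (H2 (mkposreal _ Hp)) as [M HM]; simpl in HM.
  specialize (HM M (Nat.le_refl _)).
  rewrite qpoch_add, Cmult_assoc, Cinv_l, Cmult_1_l in HM by trivial.
  assert (H3 := Cmod_qpoch_ge (a * RtoC q ^ N) q M Hq ltac:(lra)).
  apply Rabs_lt_between in HM.
  assert (Cmod (a * RtoC q ^ N) / (1 - q) <= 1 / 2)%R.
  { apply Rle_trans with ((1 - q) / 2 / (1 - q))%R.
    - apply Rmult_le_compat_r; [left; apply Rinv_0_lt_compat; lra|trivial].
    - right; field; lra. }
  lra.
Qed.

Lemma qpoch_q_neq_0 (q : R) (n : nat) : (0 < q < 1)%R -> qpoch q q n <> 0.
Proof.
  intros Hq; induction n as [|n IH]; [apply C1_nz|].
  rewrite qpoch_S; apply Cmult_neq_0; trivial.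
  rewrite <- RtoC_pow, <- RtoC_mult, <- RtoC_minus.
  intro E; apply RtoC_inj in E.
  assert (q ^ n <= 1)%R by (rewrite <- (pow1 n); apply pow_incr; lra).
  assert (0 < q ^ n)%R by (apply pow_lt; lra).
  nra.
Qed.

(** * The finite q-binomial theorem and Euler's series *)

(** By the q-Pascal rule, multiplication by [1 - t q^N] carries the sum of level [N] to that of
    level [N + 1], up to the factor [1 - q^(N+1)]. *)
Lemma qbinomial_theorem (q t : C) (N : nat) : (forall n, qpoch q q n <> 0) ->
  csum (fun l => (- (1)) ^ l * q ^ binom2 l * t ^ l
                 / (qpoch q q l * qpoch q q (N - l))) N
  = qpoch t q N / qpoch q q N.
Proof.
  intros Hqn.
  assert (Hq1 : forall n, 1 - q * q ^ n <> 0).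
  { intros n E; apply (Hqn (S n)); rewrite qpoch_S, E; ring. }
  induction N as [|N IH]; [rewrite csum_0; simpl; field|].
  set (A := fun l => (- (1)) ^ l * q ^ binom2 l * t ^ l).
  assert (E := csum_bidiagonal
    (fun l => (1 - q * q ^ N) * (A l / (qpoch q q l * qpoch q q (S N - l))))
    (fun l => A l / (qpoch q q l * qpoch q q (N - l)))
    (fun l => t * q ^ N * (A l / (qpoch q q l * qpoch q q (N - l))))
    (fun _ => 1) N).
  cbv beta in E.
  rewrite (csum_ext (fun l => A l / (qpoch q q l * qpoch q q (N - l)) * 1 - _)
    (fun l => (1 - t * q ^ N) * (A l / (qpoch q q l * qpoch q q (N - l))))),
    csum_scal in E by (intros; ring).
  change (csum (fun l => A l / (qpoch q q l * qpoch q q (N - l))) N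
          = qpoch t q N / qpoch q q N) in IH.
  rewrite IH in E.
  rewrite (csum_ext _ (fun l => / (1 - q * q ^ N) *
    ((1 - q * q ^ N) * (A l / (qpoch q q l * qpoch q q (S N - l))) * 1))), csum_scal.
  2:{ intros l _; unfold A; generalize (Hq1 N) (Hqn l) (Hqn (S N - l)%nat).
      intros; field; auto. }
  rewrite <- E.
  - rewrite !qpoch_S; generalize (Hq1 N) (Hqn N); intros; field; auto.
  - rewrite !Nat.sub_0_r, (qpoch_S q q N).
    generalize (Hq1 N) (Hqn N); intros; simpl; field; auto.
  - intros j Hj; simpl Nat.sub; replace (N - j)%nat with (S (N - S j)) by lia.
    set (l := (N - S j)%nat); replace N with (j + S l)%nat by lia.
    unfold A; rewrite !qpoch_S, binom2_S, !Cpow_add_r, !Cpow_S.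
    generalize (Hq1 j) (Hq1 l) (Hqn j) (Hqn l); intros; field; auto.
  - rewrite !Nat.sub_diag; unfold A; rewrite qpoch_S, binom2_S, Cpow_add_r, !Cpow_S.
    generalize (Hq1 N) (Hqn N); intros; simpl; field; auto.
Qed.

Lemma ex_series_euler_coef (q : R) : (0 < q < 1)%R ->
  ex_series (fun l => Cmod (euler_coef q l)).
Proof.
  intros Hq.
  assert (Hinf : clim (fun n => / qpoch q q n) (/ qpoch_inf q q)).
  { apply clim_inv; [apply qpoch_inf_neq_0; trivial; intro; now apply qpoch_q_neq_0|].
    now apply clim_qpoch_inf. }
  destruct (clim_bounded _ _ Hinf) as [K HK].
  apply (ex_series_Cmod_geom _ q K); trivial; intro l; unfold euler_coef.
  unfold Cdiv; rewrite !Cmod_mult, Cmod_pow, Cmod_m1, pow1, Rmult_1_l.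
  rewrite <- RtoC_pow, Cmod_R, Rabs_pos_eq by (apply pow_le; lra).
  rewrite Rmult_comm; apply Rmult_le_compat; try apply HK; try apply Cmod_ge_0.
  - apply pow_le; lra.
  - rewrite binom2_S, pow_add.
    assert (H1 : (q ^ binom2 l <= 1)%R)
      by (rewrite <- (pow1 (binom2 l)); apply pow_incr; lra).
    assert (H2 : (0 < q ^ l)%R) by (apply pow_lt; lra).
    nra.
Qed.

(** At [t = q] the finite theorem says that the sum of [euler_coef q l / (q)_(M-l)] is 1 for every
    [M]. By Tannery's theorem its limit is [V / (q; q)_oo], with [V] the sum of the series, which
    determines [V]. *)
Lemma clim_euler_coef (q : R) : (0 < q < 1)%R ->
  clim (csum (euler_coef q)) (qpoch_inf q q).
Proof.
  intros Hq.
  assert (Hqn : forall n, qpoch q q n <> 0) by (intro; now apply qpoch_q_neq_0).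
  assert (Hqi : qpoch_inf q q <> 0) by now apply qpoch_inf_neq_0.
  assert (Hinf : clim (fun n => / qpoch q q n) (/ qpoch_inf q q))
    by (apply clim_inv; trivial; now apply clim_qpoch_inf).
  destruct (clim_bounded _ _ Hinf) as [K HK].
  destruct (ex_clim_csum _ (ex_series_euler_coef q Hq)) as [V HV].
  assert (H1 := clim_tannery (euler_coef q) (fun M l => / qpoch q q (M - l)) V
    (/ qpoch_inf q q) K (ex_series_euler_coef q Hq) HV).
  assert (E : V * / qpoch_inf q q = 1).
  { eapply clim_unique; [apply H1|apply (clim_ext (fun _ => 1)); [|apply clim_const]].
    - intro l; apply (clim_subseq (fun M => M - l)%nat (fun n => / qpoch q q n)); trivial.
      intro N; exists (N + l)%nat; lia.
    - intros; apply HK.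
    - intro M; rewrite <- (Cinv_r (qpoch q q M)) by trivial.
      fold (qpoch q q M / qpoch q q M); rewrite <- (qbinomial_theorem q q M) by trivial.
      apply csum_ext; intros l _; unfold euler_coef.
      rewrite binom2_S, Cpow_add_r; generalize (Hqn l) (Hqn (M - l)%nat).
      intros; field; auto. }
  replace (qpoch_inf q q) with V; trivial.
  replace V with (V * / qpoch_inf q q * qpoch_inf q q) by (field; trivial).
  rewrite E; ring.
Qed.

(** * The sum of the series attached to one basis element *)

(** The weights [euler_coef q l] add up to [(q; q)_oo], which cancels the same factor in the
    denominator of [U], the limit of [aw_limit_coef]. *)
Lemma clim_csum_aw_term (q : R) (i : nat) (a b c d z : C) :
  (0 < q < 1)%R -> a <> 0 -> c <> 0 -> z <> 0 -> 1 - a * b * c * d / q <> 0 ->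
  (forall n, qpoch (a * c) q n <> 0) -> (forall n, qpoch (b * c) q n <> 0) ->
  (forall n, qpoch (c * d) q n <> 0) ->
  clim (csum (aw_term q i a b c d z))
    (c ^ i / RtoC q ^ i
     * (qpochs_inf [a * b * c * d; c * z; c / z] q
        / qpochs_inf [a * c; b * c; c * d] q)
     * aw_poly q i a b 0 d z).
Proof.
  intros Hq Ha Hc Hz HE Hac Hbc Hcd.
  assert (Hq0 : RtoC q <> 0) by (intro E; apply RtoC_inj in E; lra).
  assert (Hr : RtoC (sqrt q) * RtoC (sqrt q) = q)
    by (rewrite <- RtoC_mult, sqrt_sqrt; [easy|lra]).
  assert (Hqn : forall n, qpoch q q n <> 0) by (intro; now apply qpoch_q_neq_0).
  assert (Nq := qpoch_inf_neq_0 q q Hq Hqn).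
  assert (Nac := qpoch_inf_neq_0 _ q Hq Hac).
  assert (Nbc := qpoch_inf_neq_0 _ q Hq Hbc).
  assert (Ncd := qpoch_inf_neq_0 _ q Hq Hcd).
  assert (Hadd : forall u l, clim u l -> clim (fun n => u (i + n)%nat) l).
  { intros u l; apply clim_subseq; intro N; exists N; lia. }
  set (U := qpoch_inf (c * z) q * qpoch_inf (c / z) q * aw_poly q i a b 0 d z
    / (qpoch_inf q q * (qpoch_inf (a * c) q * qpoch_inf (b * c) q * qpoch_inf (c * d) q))).
  assert (HU : clim (aw_limit_coef q i a b c d z) U).
  { assert (Hpow : clim (fun j => c * RtoC q ^ j) 0).
    { replace (RtoC 0) with (c * 0) by ring; apply clim_mult; [apply clim_const|].
      apply clim_Cmod, (is_lim_seq_ext (fun n => q ^ n)%R).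
      - intro n; rewrite <- RtoC_pow, <- RtoC_minus, Cmod_R, Rminus_0_r, Rabs_pos_eq;
          [easy|apply pow_le; lra].
      - apply is_lim_seq_geom; rewrite Rabs_pos_eq; lra. }
    apply clim_div; [repeat apply Cmult_neq_0; trivial| |].
    - apply clim_mult; [apply clim_mult; now apply clim_qpoch_inf|].
      apply clim_aw_poly; trivial; apply clim_const.
    - apply clim_mult; [now apply clim_qpoch_inf|].
      apply clim_mult; [apply clim_mult|]; now apply Hadd, clim_qpoch_inf. }
  destruct (clim_bounded _ _ HU) as [K1 HK1].
  assert (HG := clim_qpoch_inf (a * b * c * d) q Hq).
  destruct (clim_bounded _ _ HG) as [K2 HK2].
  assert (HT := clim_tannery (euler_coef q)
    (fun M l => aw_limit_coef q i a b c d z (M - l)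
      * qpoch (a * b * c * d) q (2 * (i + (M - l)) + l))
    (qpoch_inf q q) (U * qpoch_inf (a * b * c * d) q) (K1 * K2)
    (ex_series_euler_coef q Hq) (clim_euler_coef q Hq)).
  apply (clim_ext_loc i (fun N => c ^ i / RtoC q ^ i * csum (fun l => euler_coef q l
    * (aw_limit_coef q i a b c d z (N - i - l)
       * qpoch (a * b * c * d) q (2 * (i + (N - i - l)) + l))) (N - i))).
  { intros N HN; replace (csum (aw_term q i a b c d z) N)
      with (csum (aw_term q i a b c d z) (i + (N - i))) by (f_equal; lia).
    rewrite (csum_aw_term q (sqrt q)) by trivial; f_equal.
    rewrite csum_rev; apply csum_ext; intros l Hl.
    replace (N - i - (N - i - l))%nat with l by lia; ring. }
  simpl qpochs_inf.
  replace (c ^ i / RtoC q ^ i * _ * _) with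
    (c ^ i / RtoC q ^ i * (qpoch_inf q q * (U * qpoch_inf (a * b * c * d) q))).
  2:{ assert (RtoC q ^ i <> 0) by now apply Cpow_nz. unfold U; field; auto. }
  apply clim_mult; [apply clim_const|].
  apply (clim_subseq (fun N => N - i)%nat (fun M => csum (fun l => euler_coef q l
    * (aw_limit_coef q i a b c d z (M - l)
       * qpoch (a * b * c * d) q (2 * (i + (M - l)) + l))) M)).
  { intro N; exists (N + i)%nat; lia. }
  apply HT.
  - intro l; apply clim_mult.
    + apply (clim_subseq (fun M => M - l)%nat (aw_limit_coef q i a b c d z)); trivial.
      intro N; exists (N + l)%nat; lia.
    + apply (clim_subseq (fun M => 2 * (i + (M - l)) + l)%nat (qpoch _ q)); trivial.
      intro N; exists (N + l)%nat; lia.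
  - intros M l _; rewrite Cmod_mult; apply Rmult_le_compat; try apply Cmod_ge_0; auto.
Qed.

(** * The connection formula *)

Lemma binom2_double (k : nat) : (2 * binom2 k + k = k * k)%nat.
Proof. induction k as [|k IH]; [easy|]; rewrite binom2_S; lia. Qed.

Lemma qpoch_inv_pow_quot (q : C) (i m : nat) : q <> 0 -> qpoch q q m <> 0 ->
  qpoch (/ q ^ (i + m)) q i =
  (- (1)) ^ i * qpoch q q (i + m) / (qpoch q q m * q ^ (i * m) * q ^ (binom2 i + i)).
Proof.
  intros Hq Hm; assert (H := qpoch_inv_pow_add q i m Hq).
  assert (E : (binom2 (i + m) = binom2 i + binom2 m + i * m)%nat).
  { assert (H1 := binom2_double (i + m)); assert (H2 := binom2_double i);
      assert (H3 := binom2_double m); nia. }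
  rewrite E, !Cpow_add_r in H; rewrite !Cpow_add_r.
  assert (q ^ binom2 m <> 0) by now apply Cpow_nz.
  assert (q ^ binom2 i <> 0) by now apply Cpow_nz.
  assert (q ^ (i * m) <> 0) by now apply Cpow_nz.
  assert (q ^ i <> 0) by now apply Cpow_nz.
  set (x := qpoch (/ (q ^ i * q ^ m)) q i) in *.
  transitivity (q ^ binom2 i * q ^ binom2 m * q ^ (i * m) * x * qpoch q q m * q ^ i
    / (q ^ binom2 m * (qpoch q q m * q ^ (i * m) * (q ^ binom2 i * q ^ i))));
    [field; auto|].
  rewrite H; field; auto.
Qed.

(** The identity [y q^s + (1 - y q^s) = 1] distributes the term [s] of level [N] over the terms [s]
    and [s + 1] of level [N + 1]. *)
Lemma qbinomial_complement (q y : C) (N : nat) : (forall n, qpoch q q n <> 0) ->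
  csum (fun s => y ^ (N - s) * qpoch y q s / (qpoch q q s * qpoch q q (N - s))) N
  = / qpoch q q N.
Proof.
  intros Hqn.
  assert (Hq1 : forall n, 1 - q * q ^ n <> 0).
  { intros n E; apply (Hqn (S n)); rewrite qpoch_S, E; ring. }
  induction N as [|N IH]; [rewrite csum_0; simpl; field|].
  set (A := fun N s => y ^ (N - s) * qpoch y q s / (qpoch q q s * qpoch q q (N - s))).
  change (csum (A N) N = / qpoch q q N) in IH; change (csum (A (S N)) (S N) = / qpoch q q (S N)).
  assert (E := csum_bidiagonal (fun s => (1 - q * q ^ N) * A (S N) s)
    (fun s => q ^ s * y * A N s) (fun s => - ((1 - y * q ^ s) * A N s)) (fun _ => 1) N).
  cbv beta in E.
  rewrite (csum_ext (fun s => q ^ s * y * A N s * 1 - _) (A N)), IH in E by (intros; ring).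
  rewrite (csum_ext _ (fun s => / (1 - q * q ^ N) * ((1 - q * q ^ N) * A (S N) s * 1))),
    csum_scal.
  2:{ intros s _; generalize (Hq1 N); intros; field; auto. }
  rewrite <- E.
  - rewrite qpoch_S; generalize (Hq1 N) (Hqn N); intros; field; auto.
  - unfold A; rewrite !Nat.sub_0_r, (qpoch_S q q N).
    generalize (Hq1 N) (Hqn N); intros; simpl; field; auto.
  - intros j Hj; unfold A.
    simpl Nat.sub; replace (N - j)%nat with (S (N - S j)) by lia.
    set (l := (N - S j)%nat); replace N with (j + S l)%nat by lia.
    rewrite !qpoch_S, !Cpow_add_r, !Cpow_S.
    generalize (Hq1 j) (Hq1 l) (Hqn j) (Hqn l); intros; field; auto.
  - unfold A; rewrite !Nat.sub_diag, !qpoch_S.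
    generalize (Hq1 N) (Hqn N); intros; simpl; field; auto.
Qed.

Lemma csum_extend (u : nat -> C) (m n : nat) :
  (m <= n)%nat -> (forall k, (m < k <= n)%nat -> u k = 0) -> csum u n = csum u m.
Proof.
  induction 1 as [|n Hmn IH]; intros H; [easy|].
  rewrite csum_S, H, IH by (try (intros; apply H); lia); ring.
Qed.

Lemma csum_shift (u : nat -> C) (l m : nat) :
  (forall k, (k < l)%nat -> u k = 0) ->
  csum u (l + m) = csum (fun s => u (l + s)%nat) m.
Proof.
  intros H; induction m as [|m IH].
  - rewrite csum_0, Nat.add_0_r; destruct l as [|l]; [apply csum_0|].
    rewrite csum_S, csum_zero; [ring|]; intros; apply H; lia.
  - now rewrite Nat.add_succ_r, !csum_S, IH, Nat.add_succ_r.
Qed.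

Definition asc_poly (q : C) (n : nat) (a b z : C) : C :=
  / a ^ n
  * csum (fun l => qpoch (/ q ^ n) q l * q ^ l / qpoch q q l * qpoch (a * b * q ^ l) q (n - l)
                   * (qpoch (a * z) q l * qpoch (a / z) q l)) n.

(** Connection formula between Al-Salam-Chihara and continuous dual q-Hahn polynomials. *)
Lemma asc_poly_connection (q : C) (n : nat) (a b d z : C) :
  q <> 0 -> (forall n, qpoch q q n <> 0) -> a <> 0 ->
  csum (fun i => qpoch q q n / (qpoch q q i * qpoch q q (n - i)) * d ^ (n - i)
                 * qpoch (a * b * q ^ i) q (n - i) * aw_poly q i a b 0 d z) n
  = asc_poly q n a b z.
Proof.
  intros Hq Hqn Ha.
  (* The inner sums, of length [i], are padded with zeros to the common length [n], so that the two
     summations can be exchanged. *)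
  rewrite (csum_ext _ (fun i => csum (fun l =>
    qpoch q q n / (qpoch q q i * qpoch q q (n - i)) * d ^ (n - i)
      * qpoch (a * b * q ^ i) q (n - i) * / a ^ i
      * (qpoch (/ q ^ i) q l * q ^ l / qpoch q q l * qpoch (a * b * q ^ l) q (i - l)
         * qpoch (a * d * q ^ l) q (i - l)
         * (qpoch (a * z) q l * qpoch (a / z) q l))) n)).
  2:{ intros i Hi; rewrite (csum_extend _ i) by
        (trivial; intros k Hk; rewrite qpoch_inv_pow by (trivial; lia); unfold Cdiv; ring).
      rewrite csum_scal; unfold aw_poly; rewrite Cmult_assoc; f_equal.
      apply csum_ext; intros l _; unfold aw_coef.
      replace (a * b * 0 * d / q * q ^ i) with (RtoC 0) by (unfold Cdiv; ring).
      replace (a * 0 * q ^ l) with (RtoC 0) by ring.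
      rewrite !qpoch_0_l; unfold Cdiv; ring. }
  rewrite csum_switch; unfold asc_poly; rewrite <- csum_scal.
  apply csum_ext; intros l Hl.
  (* For fixed [l] only [i = l + s] contributes, and the sum over [s] is [qbinomial_complement] at
     [y = a d q^l]. *)
  set (N := (n - l)%nat); replace n with (l + N)%nat at 1 by lia.
  rewrite csum_shift.
  2:{ intros k Hk; rewrite (qpoch_inv_pow q k l) by trivial; unfold Cdiv; ring. }
  rewrite (csum_ext _ (fun s => / a ^ n * (qpoch (/ q ^ n) q l * q ^ l / qpoch q q l
      * qpoch (a * b * q ^ l) q N * (qpoch (a * z) q l * qpoch (a / z) q l))
      * qpoch q q N
      * ((a * d * q ^ l) ^ (N - s) * qpoch (a * d * q ^ l) q s
          / (qpoch q q s * qpoch q q (N - s))))).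
  - rewrite csum_scal, qbinomial_complement by trivial.
    generalize (Hqn N) (Hqn l) (Cpow_nz a n Ha); intros; field; auto.
  - intros s Hs.
    replace (n - (l + s))%nat with (N - s)%nat by lia.
    replace (l + s - l)%nat with s by lia.
    replace (qpoch (a * b * q ^ l) q N)
      with (qpoch (a * b * q ^ l) q s * qpoch (a * b * q ^ (l + s)) q (N - s)).
    2:{ rewrite Cpow_add_r, Cmult_assoc, <- qpoch_add; f_equal; lia. }
    replace n with (l + N)%nat by lia.
    rewrite !qpoch_inv_pow_quot by trivial.
    rewrite !Cpow_mult_l, <- Cpow_mult_r.
    set (t := (N - s)%nat); replace N with (s + t)%nat by lia.
    rewrite Nat.mul_add_distr_l, !Cpow_add_r.
    generalize (Hqn l) (Hqn s) (Hqn t) (Hqn (s + t)%nat) (Hqn (l + s)%nat).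
    generalize (Cpow_nz a l Ha) (Cpow_nz a s Ha) (Cpow_nz a t Ha).
    generalize (Cpow_nz q (l * s) Hq) (Cpow_nz q (l * t) Hq) (Cpow_nz q (binom2 l) Hq)
      (Cpow_nz q l Hq).
    intros; field; repeat split; trivial.
Qed.

(** * From terminating hypergeometric series to finite sums *)

Lemma CSeries_finite (u : nat -> C) (n : nat) :
  (forall k, (n < k)%nat -> u k = 0) -> CSeries u = csum u n.
Proof.
  intros H; apply CSeries_unique.
  apply (clim_ext_loc n (fun _ => csum u n)); [|apply clim_const].
  intros m Hm; symmetry; apply csum_extend; trivial; intros; apply H; lia.
Qed.

Lemma qhyp_terminating (l m : list C) (q z : C) (n : nat) : q <> 0 ->
  qhyp (/ q ^ n :: l) m q z = csum (qhyp_term (/ q ^ n :: l) m q z) n.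
Proof.
  intros Hq; apply CSeries_finite; intros k Hk; unfold qhyp_term; simpl qpochs.
  unfold qpochs; simpl; rewrite qpoch_inv_pow by trivial; unfold Cdiv; ring.
Qed.

(** Includes [n = 0], where the exponent is [-1]. *)
Lemma Cpowz_pred (w : C) (n : nat) : w <> 0 -> Cpowz w (Z.of_nat n - 1) = w ^ n / w.
Proof.
  intros Hw; destruct n as [|n].
  - simpl; field; trivial.
  - replace (Z.of_nat (S n) - 1)%Z with (Z.of_nat n) by lia.
    destruct n as [|n]; [simpl; field; trivial|].
    simpl Z.of_nat; simpl Cpowz; rewrite SuccNat2Pos.id_succ, !Cpow_S; field; trivial.
Qed.

Lemma qpoch_neq_0_of_qpochs (x q : C) (l : list C) (n : nat) :
  In x l -> qpochs l q n <> 0 -> qpoch x q n <> 0.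
Proof.
  induction l as [|y l IH]; intros Hx H E; [destruct Hx|]; apply H.
  change (qpoch y q n * qpochs l q n = 0); destruct Hx as [<-|Hx].
  - rewrite E; ring.
  - destruct (Ceq_dec (qpochs l q n) 0) as [->|H']; [ring|].
    now destruct (IH Hx H').
Qed.

Lemma qpoch_quot (x q : C) (m n : nat) : (m <= n)%nat -> qpoch x q m <> 0 ->
  qpoch x q n / qpoch x q m = qpoch (x * q ^ m) q (n - m).
Proof.
  intros Hmn Hm; replace n with (m + (n - m))%nat at 1 by lia.
  rewrite qpoch_add; field; trivial.
Qed.

Lemma askey_wilson_aw_poly (n : nat) (a b c d q z : C) :
  q <> 0 -> (forall k, qpoch q q k <> 0) ->
  (forall k, qpochs [a * b; a * c; a * d] q k <> 0) ->
  askey_wilson n a b c d q z = aw_poly q n a b c d z.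
Proof.
  intros Hq Hqn H; unfold askey_wilson, aw_poly.
  rewrite qhyp_terminating, <- Cmult_assoc, <- csum_scal by trivial; f_equal.
  apply csum_ext; intros j Hj; unfold qhyp_term, aw_coef.
  rewrite Cpowz_pred by trivial.
  assert (Hab : qpoch (a * b) q j <> 0)
    by (apply (qpoch_neq_0_of_qpochs _ _ _ _) with (2 := H j); simpl; auto).
  assert (Hac : qpoch (a * c) q j <> 0)
    by (apply (qpoch_neq_0_of_qpochs _ _ _ _) with (2 := H j); simpl; auto).
  assert (Had : qpoch (a * d) q j <> 0)
    by (apply (qpoch_neq_0_of_qpochs _ _ _ _) with (2 := H j); simpl; auto).
  rewrite <- !qpoch_quot by trivial.
  replace (q ^ n / q * (a * b * c * d)) with (a * b * c * d / q * q ^ n)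
    by (field; trivial).
  simpl length; simpl Z.sub; simpl Cpowz; simpl qpochs; unfold qpochs; simpl fold_right.
  generalize (Hqn j); intros; field; auto.
Qed.

Lemma al_salam_chihara_asc_poly (n : nat) (a b q z : C) :
  q <> 0 -> (forall k, qpoch q q k <> 0) -> (forall k, qpoch (a * b) q k <> 0) ->
  al_salam_chihara n a b q z = asc_poly q n a b z.
Proof.
  intros Hq Hqn H; unfold al_salam_chihara, asc_poly.
  rewrite qhyp_terminating, <- Cmult_assoc, <- csum_scal by trivial; f_equal.
  apply csum_ext; intros j Hj; unfold qhyp_term.
  rewrite <- !qpoch_quot by trivial.
  simpl length; simpl Z.sub; simpl Cpowz; unfold qpochs; simpl fold_right.
  rewrite qpoch_0_l.
  generalize (Hqn j) (H j); intros; field; auto.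
Qed.

(** For a 3phi1 the exponent is [1 + 1 - 3 = -1], so [(-1)^i q^binom2 i] appears inverted. *)
Lemma qinv_al_salam_chihara_csum (n : nat) (a b q z : C) : q <> 0 ->
  qinv_al_salam_chihara n a b q z =
  / q ^ binom2 n * (- b) ^ n * qpoch (/ (a * b)) q n
  * csum (fun i => qpoch (/ q ^ n) q i / (qpoch q q i * qpoch (/ (a * b)) q i)
      * / ((- (1)) ^ i * q ^ binom2 i) * (q ^ n * a / b) ^ i
      * (qpoch (z / a) q i * qpoch (/ (a * z)) q i)) n.
Proof.
  intros Hq; unfold qinv_al_salam_chihara.
  rewrite qhyp_terminating by trivial.
  replace (qpochs [/ (a * b)] q n) with (qpoch (/ (a * b)) q n) by (simpl; ring).
  f_equal; apply csum_ext; intros i _; unfold qhyp_term, qpochs.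
  simpl length; simpl Z.sub; simpl fold_right; unfold Cpowz.
  change (Pos.to_nat 1) with 1%nat; rewrite Cpow_1_r, !Cmult_1_r; unfold Cdiv; ring.
Qed.

(** * Assembly of the theorem *)

(** Since [(s q)_k / (s)_k = (1 - s q^k) / (1 - s)], pairing [s] with [- s] leaves only [s * s].
    This removes the square roots of [abcd/q] and [q abcd] from the term. *)
Lemma qpoch_well_poised_ratio (s q : C) (k : nat) :
  1 - s <> 0 -> 1 + s <> 0 -> qpoch s q k <> 0 -> qpoch (- s) q k <> 0 ->
  qpoch (s * q) q k * qpoch (- (s * q)) q k / (qpoch s q k * qpoch (- s) q k)
  = (1 - s * s * q ^ (2 * k)) / (1 - s * s).
Proof.
  intros H1 H2 Hk1 Hk2.
  assert (E1 := qpoch_S_l s q k); assert (E2 := qpoch_S_l (- s) q k).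
  rewrite qpoch_S in E1, E2.
  assert (H3 : 1 - s * s <> 0)
    by (replace (1 - s * s) with ((1 - s) * (1 + s)) by ring; now apply Cmult_neq_0).
  transitivity (((1 - s) * qpoch (s * q) q k) * ((1 - - s) * qpoch (- s * q) q k)
    / (qpoch s q k * qpoch (- s) q k * (1 - s * s))).
  - replace (- s * q) with (- (s * q)) by ring; field; auto.
  - rewrite <- E1, <- E2; replace (2 * k)%nat with (k + k)%nat by lia.
    rewrite Cpow_add_r; field; auto.
Qed.

Lemma is_series_csum (f : nat -> nat -> C) (s x : nat -> C) (n : nat) :
  (forall i, clim (csum (f i)) (s i)) ->
  is_series (fun k => csum (fun i => x i * f i k) n) (csum (fun i => x i * s i) n).
Proof.
  intros H.
  apply (clim_ext (fun N => csum (fun i => x i * csum (f i) N) n)).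
  - intro N; rewrite (csum_ext _ (fun i => csum (fun k => x i * f i k) N))
      by (intros; now rewrite csum_scal).
    apply csum_switch.
  - apply clim_csum; intro i; apply clim_mult; [apply clim_const|apply H].
Qed.

Lemma RtoC_of_Im_0 (w : C) : Im w = 0%R -> w = RtoC (Re w).
Proof. destruct w as [u v]; simpl; now intros ->. Qed.

Theorem lemma5p2 (n : nat) (q : R) (a b c d z : C)
  (Hq : (0 < q < 1)%R)
  (Ha : a <> 0) (Hb : b <> 0) (Hc : c <> 0) (Hd : d <> 0)
  (Hab : Im (a * b) = 0%R /\ (0 < Re (a * b) < 1)%R)
  (Hcd : Im (c * d) = 0%R /\ (0 < Re (c * d) < 1)%R)
  (Hz : z <> 0)
  (Hden : forall k : nat,
    qpochs [RtoC q; psqrt (a * b * c * d / q); - psqrt (a * b * c * d / q);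
            a * c; b * c; c * d] q k <> 0)
  (Hden_aw : forall k : nat, qpochs [a * b; a * c; a * d] q k <> 0) :
  is_series
    (fun k : nat =>
       RtoC q ^ binom2 k * (- c) ^ k
       * (qpochs [a * b * c * d / q;
                  psqrt (q * (a * b * c * d)); - psqrt (q * (a * b * c * d))] q k
          / qpochs [RtoC q; psqrt (a * b * c * d / q); - psqrt (a * b * c * d / q);
                    a * c; b * c; c * d] q k)
       * qinv_al_salam_chihara n
           (psqrt (q / (a * b * c * d))) (psqrt (c * d / (q * (a * b)))) q
           (RtoC (Rpower q (1 / 2 - INR k)) / psqrt (a * b * c * d))
       * askey_wilson k a b c d q z)
    (/ RtoC q ^ binom2 n
     * (qpochs_inf [a * b * c * d; c * z; c / z] q
        / qpochs_inf [a * c; b * c; c * d] q)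
     * (- (c / psqrt (q * (a * b * c * d)))) ^ n
     * al_salam_chihara n a b q z).
Proof.
  destruct Hab as [Iab Rab]; destruct Hcd as [Icd Rcd].
  assert (Hq0 : RtoC q <> 0) by (intro E; apply RtoC_inj in E; lra).
  assert (Hqn : forall m, qpoch q q m <> 0) by (intro; now apply qpoch_q_neq_0).
  assert (Hin : forall x, In x [RtoC q; psqrt (a * b * c * d / q);
      - psqrt (a * b * c * d / q); a * c; b * c; c * d] ->
      forall m, qpoch x q m <> 0)
    by (intros x Hx m; exact (qpoch_neq_0_of_qpochs _ _ _ _ Hx (Hden m))).
  assert (Hs1 := Hin _ (or_intror (or_introl eq_refl))).
  assert (Hs2 := Hin _ (or_intror (or_intror (or_introl eq_refl)))).
  assert (Hac : forall m, qpoch (a * c) q m <> 0) by (apply Hin; simpl; tauto).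
  assert (Hbc : forall m, qpoch (b * c) q m <> 0) by (apply Hin; simpl; tauto).
  assert (Hcd : forall m, qpoch (c * d) q m <> 0) by (apply Hin; simpl; tauto).
  assert (Hab : forall m, qpoch (a * b) q m <> 0)
    by (intro m; apply (qpoch_neq_0_of_qpochs _ _ _ _) with (2 := Hden_aw m); simpl; auto).
  clear Hin.
  (* All the positive roots of the statement are monomials in these three. Separate roots of [ab]
     and [cd] are taken because their quotient occurs under a root as well. *)
  set (x := sqrt (Re (a * b))); set (y := sqrt (Re (c * d))); set (r := sqrt q).
  assert (Hx : (0 < x)%R) by (apply sqrt_lt_R0; lra).
  assert (Hy : (0 < y)%R) by (apply sqrt_lt_R0; lra).
  assert (Hr : (0 < r)%R) by (apply sqrt_lt_R0; lra).
  assert (Er : (r * r = q)%R) by (apply sqrt_sqrt; lra).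
  assert (Eab : a * b = RtoC (x * x))
    by (rewrite (RtoC_of_Im_0 _ Iab); unfold x; rewrite sqrt_sqrt; [easy|lra]).
  assert (Ecd : c * d = RtoC (y * y))
    by (rewrite (RtoC_of_Im_0 _ Icd); unfold y; rewrite sqrt_sqrt; [easy|lra]).
  assert (Eabcd : a * b * c * d = RtoC ((x * y) * (x * y))).
  { replace (a * b * c * d) with ((a * b) * (c * d)) by ring.
    rewrite Eab, Ecd, <- RtoC_mult; f_equal; ring. }
  assert (Hps : forall (w : C) (t : R), (0 <= t)%R -> w = RtoC (t * t) -> psqrt w = RtoC t).
  { intros w t Ht ->; unfold psqrt; simpl; now rewrite sqrt_square. }
  assert (Hxy : (0 < x * y)%R) by now apply Rmult_lt_0_compat.
  assert (P1 : psqrt (a * b * c * d / q) = RtoC (x * y / r)).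
  { apply Hps; [left; now apply Rdiv_lt_0_compat|].
    rewrite Eabcd, <- RtoC_div by lra; f_equal; rewrite <- Er; field; lra. }
  assert (P2 : psqrt (q * (a * b * c * d)) = RtoC (x * y / r) * q).
  { rewrite <- RtoC_mult; apply Hps.
    - left; apply Rmult_lt_0_compat; [now apply Rdiv_lt_0_compat|lra].
    - rewrite Eabcd, <- RtoC_mult; f_equal; rewrite <- Er; field; lra. }
  assert (P3 : psqrt (q / (a * b * c * d)) = RtoC (r / (x * y))).
  { apply Hps; [left; now apply Rdiv_lt_0_compat|].
    rewrite Eabcd, <- RtoC_div by (apply Rmult_integral_contrapositive; lra); f_equal; rewrite <- Er; field; lra. }
  assert (P4 : psqrt (c * d / (q * (a * b))) = RtoC (y / (r * x))).
  { apply Hps; [left; apply Rdiv_lt_0_compat; trivial; now apply Rmult_lt_0_compat|].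
    assert (0 < q * (x * x))%R by (apply Rmult_lt_0_compat; [lra|now apply Rmult_lt_0_compat]).
    rewrite Ecd, Eab, <- RtoC_mult, <- RtoC_div by lra; f_equal; rewrite <- Er; field; lra. }
  assert (P5 : psqrt (a * b * c * d) = RtoC (x * y)) by (apply Hps; trivial; lra).
  assert (P6 : forall k, RtoC (Rpower q (1 / 2 - INR k)) = RtoC r / RtoC q ^ k).
  { intro k; unfold Rminus; rewrite Rpower_plus, Rpower_Ropp, Rpower_pow by lra.
    replace (1 / 2)%R with (/ 2)%R by lra; rewrite Rpower_sqrt by lra.
    rewrite RtoC_mult, RtoC_inv, RtoC_pow by (apply pow_nonzero; lra); easy. }
  rewrite P1 in Hs1, Hs2, Hden |- *; rewrite P2, P3, P4, P5.
  set (X := RtoC x); set (Y := RtoC y); set (Z := RtoC r).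
  assert (HX : X <> 0) by (intro E; apply RtoC_inj in E; lra).
  assert (HY : Y <> 0) by (intro E; apply RtoC_inj in E; lra).
  assert (HZ : Z <> 0) by (intro E; apply RtoC_inj in E; lra).
  assert (EZ : Z * Z = q) by (unfold Z; rewrite <- RtoC_mult; now f_equal).
  assert (EX : a * b = X * X) by (rewrite Eab; apply RtoC_mult).
  assert (EY : c * d = Y * Y) by (rewrite Ecd; apply RtoC_mult).
  assert (Hrxy : r <> 0%R /\ (x * y)%R <> 0%R /\ (r * x)%R <> 0%R).
  { assert (0 < r * x)%R by now apply Rmult_lt_0_compat. repeat split; lra. }
  destruct Hrxy as (Hr0 & Hxy0 & Hrx0).
  set (s := RtoC (x * y / r)) in *.
  assert (Es : s = X * Y / Z) by (unfold s; now rewrite RtoC_div, RtoC_mult).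
  replace (RtoC (r / (x * y))) with (Z / (X * Y)) by (now rewrite RtoC_div, RtoC_mult).
  replace (RtoC (y / (r * x))) with (Y / (Z * X)) by (now rewrite RtoC_div, RtoC_mult).
  replace (RtoC (x * y)) with (X * Y) by now rewrite RtoC_mult.
  assert (Ess : a * b * c * d / q = s * s).
  { replace (a * b * c * d) with ((a * b) * (c * d)) by ring.
    rewrite EX, EY, Es, <- EZ; field; trivial. }
  (* The case [k = 1] of the denominator hypothesis shows that [s] and [- s] differ from 1, hence
     that [abcd/q] does. *)
  assert (Hm : 1 - s <> 0).
  { intro E; apply (Hs1 1%nat); simpl; rewrite <- E; ring. }
  assert (Hp : 1 + s <> 0).
  { intro E; apply (Hs2 1%nat); simpl; rewrite <- E; ring. }
  assert (HE : 1 - a * b * c * d / q <> 0).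
  { rewrite Ess; replace (1 - s * s) with ((1 - s) * (1 + s)) by ring.
    now apply Cmult_neq_0. }
  assert (Einv : / (Z / (X * Y) * (Y / (Z * X))) = a * b) by (rewrite EX; field; auto).
  rewrite al_salam_chihara_asc_poly, <- (asc_poly_connection q n a b d z) by trivial.
  set (K := qpochs_inf [a * b * c * d; c * z; c / z] q
            / qpochs_inf [a * c; b * c; c * d] q).
  (* The coefficient of the [i]-th basis element in the dual polynomial; it does not depend on
     [k]. *)
  set (g := fun i => / RtoC q ^ binom2 n * (- (Y / (Z * X))) ^ n * qpoch (a * b) q n
    * (qpoch (/ RtoC q ^ n) q i / (qpoch q q i * qpoch (a * b) q i)
       * / ((- (1)) ^ i * RtoC q ^ binom2 i) * (RtoC q ^ n * q / (c * d)) ^ i)).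
  rewrite <- csum_scal.
  rewrite (csum_ext _ (fun i => g i * (c ^ i / RtoC q ^ i * K * aw_poly q i a b 0 d z))).
  - eapply is_series_ext;
      [|apply (is_series_csum (fun i => aw_term q i a b c d z)); intro i;
        now apply clim_csum_aw_term].
    intro k; cbv beta.
    rewrite qinv_al_salam_chihara_csum, askey_wilson_aw_poly, Einv, P6 by trivial.
    fold Z.
    rewrite <- csum_scal, <- csum_scal, Cmult_comm, <- csum_scal.
    apply csum_ext; intros i _; unfold g, aw_term.
    assert (Hqk : RtoC q ^ k <> 0) by now apply Cpow_nz.
    (* At the argument [q^(1/2-k) / sqrt (abcd)] the two factorials of the dual polynomial become
       [(q^-k)_i] and [(abcd q^(k-1))_i]. *)
    replace (Z / RtoC q ^ k / (X * Y) / (Z / (X * Y))) with (/ RtoC q ^ k)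
      by (field; auto).
    replace (/ (Z / (X * Y) * (Z / RtoC q ^ k / (X * Y))))
      with (a * b * c * d / q * RtoC q ^ k).
    2:{ rewrite Ess, Es; field; auto. }
    replace (RtoC q ^ n * (Z / (X * Y)) / (Y / (Z * X))) with (RtoC q ^ n * q / (c * d)).
    2:{ rewrite EY, <- EZ; field; auto. }
    assert (Hw := qpoch_well_poised_ratio s q k Hm Hp (Hs1 k) (Hs2 k)).
    rewrite <- Ess in Hw.
    replace (qpochs [a * b * c * d / q; s * q; - (s * q)] q k
          / qpochs [RtoC q; s; - s; a * c; b * c; c * d] q k)
      with (qpoch (a * b * c * d / q) q k
        * (qpoch (s * q) q k * qpoch (- (s * q)) q k / (qpoch s q k * qpoch (- s) q k))
        / (qpoch q q k * (qpoch (a * c) q k * qpoch (b * c) q k * qpoch (c * d) q k))).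
    2:{ unfold qpochs; simpl fold_right.
        generalize (Hqn k) (Hs1 k) (Hs2 k) (Hac k) (Hbc k) (Hcd k).
        intros; field; repeat split; trivial. }
    rewrite Hw; unfold Cdiv; ring.
  - intros i Hi; symmetry; unfold g.
    (* The root [c / sqrt (q abcd)] equals [sqrt (cd / (q ab)) / d]. Its [n]-th power turns the
       [d^(n-i)] of the connection formula into the [d^-i] that [g i] contributes together with
       [c^i / q^i]. *)
    assert (Eb : - (c / (s * q)) = - (Y / (Z * X)) * / d).
    { rewrite Es, <- EZ; replace c with (Y * Y / d) by (rewrite <- EY; field; trivial).
      field; auto. }
    rewrite Eb, Cpow_mult_l, Cpow_inv by trivial.
    set (B := (- (Y / (Z * X))) ^ n).
    set (m := (n - i)%nat); assert (Hn : n = (i + m)%nat) by lia.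
    unfold B; clear B; set (B := (- (Y / (Z * X))) ^ n); clearbody B m; subst n.
    rewrite qpoch_inv_pow_quot by trivial.
    (* From [(i + m) i = i m + i^2] and [i^2 = 2 binom2 i + i]; these powers cancel those of the
       reversed [(q^-n)_i] and of the 3phi1. *)
    assert (Ei : ((RtoC q ^ (i + m)) ^ i = RtoC q ^ (i * m) * RtoC q ^ (binom2 i + i)
                  * RtoC q ^ binom2 i)).
    { rewrite <- Cpow_mult_r, <- !Cpow_add_r; f_equal.
      assert (H := binom2_double i); nia. }
    assert (Ec : (RtoC q ^ (i + m) * q / (c * d)) ^ i
      = (RtoC q ^ (i + m)) ^ i * RtoC q ^ i / (c ^ i * d ^ i)).
    { unfold Cdiv; rewrite !Cpow_mult_l, Cpow_inv, Cpow_mult_l; [easy|].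
      now apply Cmult_neq_0. }
    rewrite Ec, Ei, (qpoch_add (a * b)), (Cpow_add_r d).
    generalize (Hab i) (Hqn i) (Hqn m) (Cpow_nz _ i Hc) (Cpow_nz _ i Hd)
      (Cpow_nz _ m Hd) (Cpow_nz _ i Hq0) (Cpow_nz _ (i * m) Hq0)
      (Cpow_nz _ (binom2 i) Hq0) (Cpow_nz _ (binom2 i + i) Hq0)
      (Cpow_nz _ (binom2 (i + m)) Hq0).
    assert (S1 := Cpow_m1_sqr i).
    assert (S0 : (- (1)) ^ i <> 0)
      by (intro E; rewrite E, Cmult_0_l in S1; now apply C1_nz).
    intros; field; repeat split; trivial.
Qed.
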